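(* Let $(G_t)_{t\in T}$ be a family of bounded domains in $\mathbb{C}^n$ with $\mathcal{C}^2$-smooth boundaries, where $T$ is a compact metric space with associated metric $d$. Suppose we have a domain $U\subset\subset\mathbb{C}^n$ such that $\bigcup_{t\in T}\partial G_t\subset\subset U$ and with the property that for any $\varepsilon>0$ there exists a $\delta>0$ such that for any $s,t\in T$ with $d(s,t)\leq\delta$ we have $\|r_t-r_s\|_{\mathcal{C}^2(U)}<\varepsilon$, where $r_t$ denotes a defining function for $G_t$, defined on $U$ for any $t\in T$. Let $K\subset\mathbb{C}^n$ be a compact set such that $K\subset G_t$ for any $t\in T$. Then there exists a constant $C>0$ such that for any $t\in T$ we have $$\boldsymbol{k}_{G_t}(z,w)\leq-\frac{1}{2}\log\mathrm{dist}(w,\partial G_t)+C$$ whenever $z\in K$ and $w\in G_t$. In particular, if $(G_j)_{j\in\mathbb{N}}$ is a sequence of bounded domains with $\mathcal{C}^2$-smooth boundaries such that $G_j$ converges to $G$, a bounded domain with $\mathcal{C}^2$-smooth boundary, with respect to the $\mathcal{C}^2$ topology on domains, then for every compact $K\subset G$ there exists a constant $C_1>0$ such that for sufficiently large $j$ $$\boldsymbol{k}_{G_j}(z,w)\leq-\frac{1}{2}\log\mathrm{dist}(w,\partial G_j)+C_1$$ whenever $z\in K$ and $w\in G_j$.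
   Context: Notation: $\mathbb{D}$ is the open unit disc in $\mathbb{C}$; $\mathrm{dist}$ is Euclidean distance; $\mathcal{O}(\mathbb{D},G)$ is the set of holomorphic maps $\mathbb{D}\to G$; $A\subset\subset B$ means that $A$ is relatively compact in $B$. $\boldsymbol{p}$ is the Poincaré distance on $\mathbb{D}$, normalized so that $\boldsymbol{p}(0,\lambda)=\frac12\log\frac{1+|\lambda|}{1-|\lambda|}$. The Kobayashi pseudodistance of a domain $G$ is $$\boldsymbol{k}_G(z,w):=\inf\Big\{\sum_{j=1}^N\boldsymbol{p}(\xi_j,\zeta_j)\Big\},\quad z,w\in G,$$ the infimum being over all $N\in\mathbb{N}$, $\xi_j,\zeta_j\in\mathbb{D}$, such that there exist $p_0,\ldots,p_N\in G$ with $p_0=z$, $p_N=w$ and $f_j\in\mathcal{O}(\mathbb{D},G)$ with $f_j(\xi_j)=p_{j-1}$, $f_j(\zeta_j)=p_j$, $j=1,\ldots,N$. A defining function for $G$ on a neighborhood $U$ of $\partial G$ is a $\mathcal{C}^2$ function $r:U\to\mathbb{R}$ with $G\cap U=\{z\in U:r(z)<0\}$, $(\mathbb{C}^n\setminus\overline{G})\cap U=\{z\in U:r(z)>0\}$, and $\left(\frac{\partial r}{\partial\bar z_1}(z),\ldots,\frac{\partial r}{\partial\bar z_n}(z)\right)\neq 0$ for $z\in\partial G$. Convergence $G_j\to G$ in the $\mathcal{C}^2$ topology on domains means: there are a bounded open set $U\subset\mathbb{C}^n$ and $j_0$ with $\partial G\cup\bigcup_{j\ge j_0}\partial G_j\subset\subset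 U$, and $\mathcal{C}^2$ defining functions $r$ of $G$ and $r_j$ of $G_j$ ($j\ge j_0$) on $U$ with $\|r_j-r\|_{\mathcal{C}^2(U)}\to0$. *)

(* Defs.v *)
From HB Require Import structures.
From mathcomp Require Import all_boot all_order all_algebra.
From mathcomp Require Import complex.
From mathcomp Require Import all_classical all_reals all_analysis.

Set Implicit Arguments.
Unset Strict Implicit.
Unset Printing Implicit Defensive.

Import Order.TTheory GRing.Theory Num.Theory.
Import numFieldNormedType.Exports.

Local Open Scope classical_set_scope.
Local Open Scope ring_scope.
Local Open Scope complex_scope.

(* R[i] with the topology of its modulus, as a normed space over itself. *)
HB.instance Definition _ (R : rcfType) := GRing.ComAlgebra.copy R[i] R[i]^o.
HB.instance Definition _ (R : rcfType) := Vector.copy R[i] R[i]^o.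
HB.instance Definition _ (R : rcfType) := NormedModule.copy R[i] R[i]^o.

Section SeveralComplexVariables.
Context {R : realType}.

(* The library norm on R[i] takes its values in R[i]; this one is real. *)
Definition cmod (l : R[i]) : R := ComplexField.Normc.normc l.

Definition unit_disc : set R[i] := [set l | cmod l < 1].

(* p(xi, zeta) = artanh |(xi - zeta) / (1 - conj(zeta) xi)|, so that
   p(0, l) = 1/2 log ((1 + |l|) / (1 - |l|)). *)
Definition poincare (xi zeta : R[i]) : R :=
  let m := cmod ((xi - zeta) / (1 - zeta^* * xi)) in
  2^-1 * ln ((1 + m) / (1 - m)).

Section Space.
Context {n : nat}.
Local Notation Cn := 'rV[R[i]]_n.
Implicit Types (A B G U : set Cn) (z w : Cn) (f r : Cn -> R).

(* The library norm on matrices is the maximum norm: it induces the usual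
   topology, but distances here are Euclidean. *)
Definition enorm z : R := Num.sqrt (\sum_(k < n) cmod (z ord0 k) ^+ 2).

Definition eudist z A : R := inf [set enorm (z - a) | a in A].

Definition ebounded A := exists M : R, forall z, A z -> enorm z <= M.

Definition boundary A : set Cn := closure A `\` interior A.

Definition relcompact A B := compact (closure A) /\ closure A `<=` B.

Definition domain G := [/\ open G, connected G & G !=set0].

Definition bounded_domain G := domain G /\ ebounded G.

(* The 2n real coordinate directions of C^n: (k, false) stands for x_k and
   (k, true) for y_k, where z_k = x_k + i y_k. *)
Definition direction (a : 'I_n * bool) : Cn :=
  (if a.2 then 0 +i* 1 else 1) *: delta_mx ord0 a.1.

Definition along (a : 'I_n * bool) f z : R -> R :=
  fun t => f (z + t%:C *: direction a).

Definition rpartial (a : 'I_n * bool) f z : R := derive1 (along a f z) 0.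

(* The functions below are total, but for open U the values of f and of its
   derivatives at points of U only depend on the restriction of f to U. *)
Definition C1_on U f :=
  (forall z, U z -> {for z, continuous f}) /\
  forall a z, U z ->
    derivable (along a f z) 0 1 /\ {for z, continuous (rpartial a f)}.

Definition C2_on U f := C1_on U f /\ forall a, C1_on U (rpartial a f).

Definition supnorm U f : \bar R := ereal_sup [set `|f z|%:E | z in U].

Definition C2norm U f : \bar R :=
  maxe (supnorm U f)
    (maxe (\big[maxe/0%E]_(a : 'I_n * bool) supnorm U (rpartial a f))
       (\big[maxe/0%E]_(a : 'I_n * bool) \big[maxe/0%E]_(b : 'I_n * bool)
          supnorm U (rpartial b (rpartial a f)))).

(* (d r / d conj(z_1), ..., d r / d conj(z_n)), where
   d / d conj(z_k) = (d / d x_k + i d / d y_k) / 2. *)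
Definition dbar r z : Cn :=
  \row_k ((rpartial (k, false) r z / 2) +i* (rpartial (k, true) r z / 2)).

Definition defining_function G U r :=
  [/\ open U /\ boundary G `<=` U,
      C2_on U r,
      G `&` U = [set z | U z /\ r z < 0],
      ~` closure G `&` U = [set z | U z /\ 0 < r z]
    & forall z, boundary G z -> dbar r z != 0].

Definition C2_boundary G := exists U r, defining_function G U r.

Definition C2_converges (Gs : nat -> set Cn) G :=
  exists U, exists j0 : nat,
    [/\ open U, ebounded U,
        relcompact
          (boundary G `|` \bigcup_(j in [set j | (j0 <= j)%N]) boundary (Gs j))
          U
      & exists r, exists rs : nat -> Cn -> R,
          [/\ defining_function G U r,
              forall j, (j0 <= j)%N -> defining_function (Gs j) U (rs j)
            & C2norm U (fun z => rs j z - r z) @[j --> \oo] --> 0%E]].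

(* phi is a total function, but only its values on the disc matter. *)
Definition holomorphic_disc G (phi : R[i] -> Cn) :=
  forall l, unit_disc l -> derivable phi l 1 /\ G (phi l).

(* The set of the sums sum_j p(xi_j, zeta_j) over all chains of N discs from z
   to w; the j-th disc of the definition (1 <= j <= N) has index j - 1. *)
Definition chain_lengths G z w : set R :=
  [set s | exists N (xi zeta : nat -> R[i]) (p : nat -> Cn)
             (phi : nat -> R[i] -> Cn),
     [/\ (0 < N)%N /\ (forall j, (j <= N)%N -> G (p j)),
         p 0%N = z /\ p N = w,
         forall j, (j < N)%N ->
           [/\ unit_disc (xi j), unit_disc (zeta j),
               holomorphic_disc G (phi j),
               phi j (xi j) = p j & phi j (zeta j) = p j.+1]
       & s = \sum_(j < N) poincare (xi j) (zeta j)]].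

(* The infimum is taken in the extended reals, where it is +oo if there is no
   chain from z to w in G, in particular if z or w is not in G. *)
Definition kobayashi G z w : \bar R :=
  ereal_inf [set s%:E | s in chain_lengths G z w].

End Space.
End SeveralComplexVariables.

(* Main.v *)
Require Import Defs.
From HB Require Import structures.
From mathcomp Require Import all_boot all_order all_algebra.
From mathcomp Require Import complex.
From mathcomp Require Import all_classical all_reals all_analysis.
From mathcomp Require Import lra ring.
Import Order.TTheory GRing.Theory Num.Theory.
Import numFieldNormedType.Exports.
Local Open Scope classical_set_scope.
Local Open Scope ring_scope.

Set Implicit Arguments.
Unset Strict Implicit.
Unset Printing Implicit Defensive.

(** Both assertions are consequences of one local statement,
[kobayashi_upper_bound]: around a domain [G0] with defining function [r0] on
[U], the same constant [C] serves for every domain [G] whose boundary stays in a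
fixed compact part [L] of [U] and which has a defining function [r] on [U] with
[r - r0] small in the C^2 norm. In the first assertion each [G t] has such a
neighbourhood, and compactness of [T] reduces them to finitely many constants; in
the second one the [Gs j] eventually lie in the neighbourhood of [G].

For the local statement the points [w] of [G] are split into two kinds.

If [w] is close to [L] and [eta = - r w] is small, then [r] has a gradient bounded
away from zero and bounded second derivatives near [w] ([uniform_control]). On the
complex line through [w] in the direction of the gradient [v], Taylor's formula
reads
  [r (w + l v) <= - eta + |v|^2 (Re l + |l|^2 / (2 rho))]
for a constant [rho], and the right-hand side is negative on the disc of center
[- rho] and radius [rho + tau], where [tau] is a constant multiple of [eta]. This
disc lies in [G], contains [w], and the Poincare distance from its center to [w]
is at most [- 1/2 log eta] plus a constant. On the real ray [l > 0] the corresponding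
lower bound forces [r > 0] after a step of length [O(eta)], so that [w] has distance
[O(eta)] to the boundary and [- 1/2 log eta] is bounded by [- 1/2 log] of that
distance plus a constant. All this is [disc_estimate]; the center of the disc
satisfies [r <= - k] with a fixed [k > 0], so it is of the second kind.

If [w] is away from [L], or if [r w <= - k], then [w] is joined to a base point
of [G0] by a chain of discs in [G] of uniformly bounded length ([joined_deep]).
Indeed every point of [G0] has a neighbourhood contained in all [G] close to [G0],
and every exterior point of [G0] has one disjoint from all of them
([stable_inside], [stable_outside]); as [G0] is connected, chains of small balls
lead to a locally uniform bound ([uniformly_joined_all]), and compactness makes it
uniform. The same argument joins the points of [K] to the base point. *)

(** * Real coordinates and the sum norm *)

Section Coordinates.
Context {R : realType} {n : nat}.
Local Notation Cn := 'rV[R[i]]_n.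
Implicit Types (z w v : Cn) (a b : 'I_n * bool).

Definition rcoord a z : R :=
  if a.2 then complex.Im (z ord0 a.1) else complex.Re (z ord0 a.1).

(** The sum norm of the [2n] real coordinates fits estimates that move along one
real coordinate direction at a time: partial sums of the coordinate decomposition
of a vector are never longer than the vector itself. *)
Definition norm1 z : R := \sum_a `|rcoord a z|.

Definition rscale (t : R) z : Cn := (t%:C)%C *: z.

Lemma ReD (x y : R[i]) : complex.Re (x + y) = complex.Re x + complex.Re y.
Proof. by case: x; case: y. Qed.

Lemma ImD (x y : R[i]) : complex.Im (x + y) = complex.Im x + complex.Im y.
Proof. by case: x; case: y. Qed.

Lemma rcoordD a z w : rcoord a (z + w) = rcoord a z + rcoord a w.
Proof. by rewrite /rcoord !mxE ReD ImD; case: ifP. Qed.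

Lemma rcoordN a z : rcoord a (- z) = - rcoord a z.
Proof. by rewrite /rcoord !mxE; case: (z _ _) => x y /=; case: ifP. Qed.

Lemma rcoordB a z w : rcoord a (z - w) = rcoord a z - rcoord a w.
Proof. by rewrite rcoordD rcoordN. Qed.

Lemma rcoord0 a : rcoord a 0 = 0.
Proof. by rewrite /rcoord !mxE; case: ifP. Qed.

Lemma rcoord_rscale a t z : rcoord a (rscale t z) = t * rcoord a z.
Proof.
rewrite /rcoord !mxE; case: (z _ _) => x y /=.
by rewrite !mul0r subr0 addr0; case: ifP.
Qed.

Lemma rcoord_sum a (I : Type) (s : seq I) (F : I -> Cn) :
  rcoord a (\sum_(i <- s) F i) = \sum_(i <- s) rcoord a (F i).
Proof. exact: (big_morph _ (rcoordD a) (rcoord0 a)). Qed.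

Lemma rcoord_direction a b : rcoord a (direction b) = (a == b)%:R :> R.
Proof.
case: a => k x; case: b => l y.
rewrite /rcoord /direction !mxE eqxx /= xpair_eqE.
by case: (k == l); case: x; case: y => /=; rewrite ?mulr1 ?mulr0 ?mul1r ?mul0r ?subr0 ?addr0 ?add0r.
Qed.

Lemma rcoord_inj z w : (forall a, rcoord a z = rcoord a w) -> z = w.
Proof.
move=> h; apply/rowP => k.
have := h (k, false); have := h (k, true); rewrite /rcoord /=.
by case: (z _ _) => x y; case: (w _ _) => x' y' /= -> ->.
Qed.

Lemma rcoord_comb (F : 'I_n * bool -> R) a :
  rcoord a (\sum_b rscale (F b) (direction b)) = F a.
Proof.
rewrite rcoord_sum (bigD1 a) //= rcoord_rscale rcoord_direction eqxx mulr1.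
rewrite big1 ?addr0 // => b ba.
by rewrite rcoord_rscale rcoord_direction eq_sym (negbTE ba) mulr0.
Qed.

Lemma rcoord_decomp z : z = \sum_a rscale (rcoord a z) (direction a).
Proof. by apply: rcoord_inj => b; rewrite rcoord_comb. Qed.

Lemma norm1_ge0 z : 0 <= norm1 z.
Proof. by apply: sumr_ge0. Qed.

Lemma norm1_0 : norm1 0 = 0.
Proof. by rewrite /norm1 big1 // => a _; rewrite rcoord0 normr0. Qed.

Lemma norm1D z w : norm1 (z + w) <= norm1 z + norm1 w.
Proof.
by rewrite -big_split /=; apply: ler_sum => a _; rewrite rcoordD ler_normD.
Qed.

Lemma norm1N z : norm1 (- z) = norm1 z.
Proof. by apply: eq_bigr => a _; rewrite rcoordN normrN. Qed.

Lemma norm1_sym z w : norm1 (z - w) = norm1 (w - z).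
Proof. by rewrite -norm1N opprB. Qed.

Lemma norm1_tri v z w : norm1 (z - w) <= norm1 (z - v) + norm1 (v - w).
Proof. by apply: le_trans (norm1D _ _); rewrite addrA subrK. Qed.

Lemma norm1_rscale t z : norm1 (rscale t z) = `|t| * norm1 z.
Proof.
by rewrite /norm1 mulr_sumr; apply: eq_bigr => a _; rewrite rcoord_rscale normrM.
Qed.

Lemma norm1_direction a : norm1 (direction a) = 1 :> R.
Proof.
rewrite /norm1 (bigD1 a) //= rcoord_direction eqxx normr1 big1 ?addr0 // => b ba.
by rewrite rcoord_direction (negbTE ba) normr0.
Qed.

Lemma sum_directions (F : 'I_n * bool -> R) :
  \sum_a F a = \sum_(k < n) (F (k, false) + F (k, true)).
Proof.
transitivity (\sum_(k < n) \sum_(b : bool) F (k, b)).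
  by rewrite pair_bigA; apply: eq_bigr => -[].
by apply: eq_bigr => k _; rewrite big_bool addrC.
Qed.

Lemma norm1_pair z : norm1 z =
  \sum_(k < n) (`|complex.Re (z ord0 k)| + `|complex.Im (z ord0 k)|).
Proof. exact: sum_directions. Qed.

Lemma cmod_le_re_im (l : R[i]) : cmod l <= `|complex.Re l| + `|complex.Im l|.
Proof.
case: l => x y /=; rewrite /cmod /=.
have h : 0 <= `|x| + `|y| by rewrite addr_ge0.
rewrite -[leRHS]ger0_norm // -sqrtr_sqr ler_wsqrtr //.
rewrite -(real_normK (num_real x)) -(real_normK (num_real y)).
by have := mulr_ge0 (normr_ge0 x) (normr_ge0 y); nra.
Qed.

Lemma re_im_le_cmod (l : R[i]) : `|complex.Re l| + `|complex.Im l| <= 2 * cmod l.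
Proof.
case: l => x y /=; rewrite /cmod /=.
have hx : `|x| <= Num.sqrt (x ^+ 2 + y ^+ 2).
  by rewrite -sqrtr_sqr ler_wsqrtr // lerDl sqr_ge0.
have hy : `|y| <= Num.sqrt (x ^+ 2 + y ^+ 2).
  by rewrite -sqrtr_sqr ler_wsqrtr // lerDr sqr_ge0.
lra.
Qed.

Lemma norm1_scale (l : R[i]) z :
  norm1 (l *: z) <= (`|complex.Re l| + `|complex.Im l|) * norm1 z.
Proof.
rewrite !norm1_pair mulr_sumr; apply: ler_sum => k _; rewrite !mxE.
case: l => s t; case: (z _ _) => x y /=.
apply: le_trans (lerD (ler_normB _ _) (ler_normD _ _)) _.
by rewrite !normrM; lra.
Qed.

Lemma cmod_ge0 (l : R[i]) : 0 <= cmod l.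
Proof. by case: l => x y; exact: sqrtr_ge0. Qed.

Lemma enorm_le_norm1 z : enorm z <= norm1 z.
Proof.
rewrite /enorm; apply: (@le_trans _ _ (\sum_(k < n) cmod (z ord0 k))); last first.
  by rewrite norm1_pair; apply: ler_sum => k _; exact: cmod_le_re_im.
set x := fun k => cmod (z ord0 k).
have x0 k : 0 <= x k by exact: cmod_ge0.
have s0 : 0 <= \sum_k x k by apply: sumr_ge0.
rewrite -[leRHS]ger0_norm // -sqrtr_sqr ler_wsqrtr // expr2 mulr_suml.
apply: ler_sum => k _; rewrite -[cmod _]/(x k) expr2 ler_wpM2l //.
by rewrite (bigD1 k) //= lerDl sumr_ge0 // => i _; exact: x0.
Qed.

Lemma cmod_le_enorm z k : cmod (z ord0 k) <= enorm z.
Proof.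
rewrite /enorm -[leLHS]ger0_norm ?cmod_ge0 // -sqrtr_sqr ler_wsqrtr //.
by rewrite (bigD1 k) //= lerDl sumr_ge0 // => i _; exact: sqr_ge0.
Qed.

Lemma norm1_le_enorm z : norm1 z <= 2 * n%:R * enorm z.
Proof.
rewrite norm1_pair (le_trans (ler_sum _ (fun k _ => re_im_le_cmod (z ord0 k)))) //.
rewrite -mulr_sumr -mulrA ler_wpM2l //.
rewrite (le_trans (ler_sum _ (fun k _ => cmod_le_enorm z k))) //.
by rewrite sumr_const card_ord mulr_natl.
Qed.

Lemma complex_gt0 (e : R[i]) : 0 < e ->
  0 < complex.Re e /\ e = ((complex.Re e)%:C)%C.
Proof. by case: e => x y; rewrite /= ltcE /= => /andP[/eqP -> ?]. Qed.

(** This characterization replaces the topology of the maximum norm, whose radii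
are elements of [R[i]], by balls of real radius for [norm1]. *)
Lemma nbhs_norm1 z (A : set Cn) :
  nbhs z A <-> exists2 s : R, 0 < s & forall w, norm1 (w - z) < s -> A w.
Proof.
split.
- move/nbhs_ballP => [e e0 he].
  have [e'0 ee] := complex_gt0 e0.
  exists (complex.Re e) => // w wz; apply: he; split => // i j.
  rewrite (ord1 i) -ball_normE /ball_ /= ee ltcR.
  apply: le_lt_trans wz; rewrite -norm1_sym.
  rewrite (_ : z ord0 j - w ord0 j = (z - w) ord0 j); last by rewrite !mxE.
  exact: le_trans (cmod_le_enorm (z - w) j) (enorm_le_norm1 _).
- move=> [s s0 hs]; apply/nbhs_ballP.
  have n0 : 0 < 2 * (n.+1)%:R :> R by rewrite mulr_gt0 // ltr0Sn.
  exists ((s / (2 * (n.+1)%:R))%:C)%C; first by rewrite /= ltcR divr_gt0.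
  move=> w [_ hw]; apply: hs.
  rewrite norm1_sym norm1_pair.
  have hk k : `|complex.Re ((z - w) ord0 k)| + `|complex.Im ((z - w) ord0 k)|
      <= s / (n.+1)%:R.
    apply: (le_trans (re_im_le_cmod _)).
    have := hw ord0 k; rewrite -ball_normE /ball_ /= ltcR => /ltW h.
    rewrite (_ : (z - w) ord0 k = z ord0 k - w ord0 k); last by rewrite !mxE.
    have -> : s / n.+1%:R = 2 * (s / (2 * n.+1%:R)).
      have : n.+1%:R != 0 :> R by rewrite pnatr_eq0.
      by move: (n.+1%:R) => m m0; field.
    by rewrite ler_pM2l.
  apply: le_lt_trans (ler_sum _ (fun k _ => hk k)) _.
  rewrite sumr_const card_ord -[ltLHS]mulr_natr -mulrA gtr_pMr // mulrC.
  by rewrite ltr_pdivrMr ?ltr0Sn // mul1r ltr_nat.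
Qed.

Lemma near_norm1 z (s : R) : 0 < s -> \forall w \near z, norm1 (w - z) < s.
Proof. by move=> s0; apply/nbhs_norm1; exists s. Qed.

End Coordinates.

(** * Segments and boundaries *)

Section Segments.
Context {R : realType} {n : nat}.
Local Notation Cn := 'rV[R[i]]_n.
Implicit Types (z w v y : Cn) (G U : set Cn) (r : Cn -> R).

Lemma rscale0 v : rscale 0 v = 0.
Proof. by rewrite /rscale (_ : (0%:C)%C = 0) // scale0r. Qed.

Lemma rscale1 v : rscale 1 v = v.
Proof. by rewrite /rscale (_ : (1%:C)%C = 1) // scale1r. Qed.

Lemma rscaleBl s t v : rscale s v - rscale t v = rscale (s - t) v.
Proof.
by apply: rcoord_inj => a; rewrite rcoordB !rcoord_rscale mulrBl.
Qed.

Lemma line_continuous z v : continuous (fun t : R => z + rscale t v).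
Proof.
move=> t A /nbhs_norm1 [s s0 hs]; rewrite nbhs_nearE near_simpl.
have d0 : 0 < s / (1 + norm1 v) by rewrite divr_gt0 // ltr_pwDl ?norm1_ge0.
near=> u.
apply: hs; rewrite opprD addrACA subrr add0r rscaleBl norm1_rscale.
have : `|u - t| < s / (1 + norm1 v).
  rewrite distrC; near: u; apply/nbhs_ballP.
  by exists (s / (1 + norm1 v)) => // u; rewrite -ball_normE.
rewrite ltr_pdivlMr ?ltr_pwDl ?norm1_ge0 //; apply: le_lt_trans.
by rewrite ler_wpM2l // lerDr.
Unshelve. all: by end_near. Qed.

(** Otherwise closure and interior of [G] would have the same trace on the segment,
which would then be disconnected by [G]. *)
Lemma segment_boundary G z y : G z -> ~ G y ->
  exists t : R, 0 <= t <= 1 /\ boundary G (z + rscale t (y - z)).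
Proof.
move=> Gz Gy; apply: contrapT => hno.
pose g := fun t : R => z + rscale t (y - z).
have cg : continuous g by exact: line_continuous.
have hb t : 0 <= t <= 1 -> closure G (g t) -> interior G (g t).
  by move=> t01 ct; apply: contrapT => it; apply: hno; exists t.
have h : [set` `[0%R, 1%R]] `&` g @^-1` G = [set` `[0%R, 1%R]].
  apply: (@segment_connected R 0 1).
  - exists 0; split; first by rewrite /= in_itv /= lexx ler01.
    by rewrite /= /g rscale0 addr0.
  - exists (g @^-1` interior G); first exact: open_comp (fun x _ => cg x) (open_interior G).
    apply/seteqP; split => t /= [t01 ht]; split => //.
      by apply: hb; [move: t01; rewrite in_itv | exact: subset_closure].
    exact: interior_subset ht.
  - exists (g @^-1` closure G); first by apply: closed_comp (fun x _ => cg x) (@closed_closure _ G).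
    apply/seteqP; split => t /= [t01 ht]; split => //.
      exact: subset_closure.
    by apply: interior_subset; apply: hb => //; move: t01; rewrite in_itv.
have : [set` `[0%R, 1%R]] (1 : R) by rewrite /= in_itv /= lexx ler01.
by rewrite -h => -[_]; rewrite /= /g rscale1 addrC subrK.
Qed.

Lemma boundary_notin G z : open G -> boundary G z -> ~ G z.
Proof. by move=> oG [_]; rewrite (interior_id _).1. Qed.

Lemma defining_zero G U r z : open G -> defining_function G U r ->
  boundary G z -> U z /\ r z = 0.
Proof.
move=> oG [[oU sub] _ hG hE _] bz; have Uz := sub _ bz; split => //.
apply/eqP; rewrite eq_le !leNgt; apply/andP; split; apply/negP => hr.
- have : (~` closure G `&` U) z by rewrite hE.
  by case=> + _; apply; case: bz.
- have : (G `&` U) z by rewrite hG.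
  by case=> + _; exact: boundary_notin.
Qed.

Lemma defining_in G U r z : defining_function G U r -> U z -> (G z <-> r z < 0).
Proof.
move=> [_ _ hG _ _] Uz; split => [Gz|rz].
  have : (G `&` U) z by [].
  by rewrite hG => -[].
have : (G `&` U) z by rewrite hG.
by case.
Qed.

Lemma defining_boundary G U r z : open G -> defining_function G U r ->
  U z -> r z = 0 -> boundary G z.
Proof.
move=> oG df Uz rz; split.
  apply: contrapT => cz; case: df => _ _ _ hE _.
  have : (~` closure G `&` U) z by [].
  by rewrite hE => -[_]; rewrite rz ltxx.
by rewrite (interior_id _).1 // => /(defining_in df Uz); rewrite rz ltxx.
Qed.

End Segments.

(** * Chains of holomorphic discs *)

Section Chains.
Context {R : realType} {n : nat}.
Local Notation Cn := 'rV[R[i]]_n.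
Implicit Types (z w v y c : Cn) (G : set Cn) (C : R).

(** An upper bound for the Kobayashi pseudodistance that is attained by an actual
chain; unlike the infimum, it can be concatenated without an approximation. *)
Definition joined G C z w := exists2 s, chain_lengths G z w s & s <= C.

Lemma kobayashi_joined G C z w : joined G C z w -> (kobayashi G z w <= C%:E)%E.
Proof.
move=> [s hs sC]; apply: (@le_trans _ _ s%:E); last by rewrite lee_fin.
by apply: ereal_inf_lbound; exists s.
Qed.

Lemma joined_le G C C' z w : C <= C' -> joined G C z w -> joined G C' z w.
Proof. by move=> CC [s hs sC]; exists s => //; apply: le_trans CC. Qed.

Lemma joined_trans G C C' z w y :
  joined G C z w -> joined G C' w y -> joined G (C + C') z y.
Proof.
move=> [s [N [xi [ze [p [phi [[N0 pG] [p0 pN] hd ->]]]]]]] sC.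
move=> [s' [N' [xi' [ze' [p' [phi' [[N'0 pG'] [p0' pN'] hd' ->]]]]]]] sC'.
pose cc (A : Type) (f g : nat -> A) := fun j => if (j < N)%N then f j else g (j - N)%N.
exists (\sum_(j < N + N') poincare (cc _ xi xi' j) (cc _ ze ze' j)); last first.
  rewrite big_split_ord /=; apply: lerD.
    by apply: le_trans sC; apply: ler_sum => j _; rewrite /cc ltn_ord.
  apply: le_trans sC'; apply: ler_sum => j _.
  by rewrite /cc ltnNge leq_addr /= addKn.
exists (N + N')%N, (cc _ xi xi'), (cc _ ze ze'), (cc _ p p'), (cc _ phi phi').
split.
- split; first by rewrite addn_gt0 N0.
  move=> j jN; rewrite /cc; case: ltnP => h; first by apply: pG; exact: ltnW.
  by apply: pG'; rewrite leq_subLR.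
- split; first by rewrite /cc N0.
  by rewrite /cc ltnNge leq_addr /= addKn.
- move=> j jN; rewrite /cc; case: ltnP => h.
    have [h1 h2 h3 h4 h5] := hd j h; split => //.
    case: ltnP => // Nj; have -> : j.+1 = N by apply/eqP; rewrite eqn_leq h.
    by rewrite subnn p0' -pN h5; congr p; apply/eqP; rewrite eqn_leq h.
  have jN' : (j - N < N')%N by rewrite ltn_subLR.
  have [h1 h2 h3 h4 h5] := hd' _ jN'; split => //.
  by rewrite ltnNge (leq_trans h) //= subSn.
- by [].
Qed.

Lemma line_disc_derivable c v (l : R[i]) :
  derivable (fun m : R[i] => c + m *: v : Cn) l 1.
Proof.
rewrite /derivable.
apply/cvg_ex; exists v; apply: cvg_near_cst.
apply: (@filterS _ _ _ (fun h : R[i] => h != 0)).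
  move=> h h0; rewrite [h%:A]/GRing.scale /= mulr1.
  rewrite opprD addrACA subrr add0r -scalerBl addrK scalerA mulVf // scale1r.
  by [].
exact: nbhs_dnbhs_neq.
Qed.

Lemma unit_disc_real (x : R) : 0 <= x < 1 -> unit_disc (x%:C)%C.
Proof.
by move=> /andP[x0 x1]; rewrite /unit_disc /cmod /= expr0n addr0 sqrtr_sqr ger0_norm.
Qed.

Lemma poincare0r (x : R) : 0 <= x -> poincare 0 (x%:C)%C = 2^-1 * ln ((1 + x) / (1 - x)).
Proof.
move=> x0; rewrite /poincare.
have -> : (0 - (x%:C)%C) / (1 - (x%:C)%C^*%C * 0) = ((- x)%:C)%C.
  by rewrite mulr0 subr0 invr1 mulr1 sub0r; congr (_ +i* _)%C; rewrite oppr0.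
by rewrite /cmod /= expr0n addr0 sqrrN sqrtr_sqr ger0_norm.
Qed.

Lemma poincarer0 (x : R) : 0 <= x -> poincare (x%:C)%C 0 = 2^-1 * ln ((1 + x) / (1 - x)).
Proof.
move=> x0; rewrite /poincare.
have -> : ((x%:C)%C - 0) / (1 - 0^*%C * (x%:C)%C) = (x%:C)%C.
  by rewrite conjc0 mul0r !subr0 invr1 mulr1.
by rewrite /cmod /= expr0n addr0 sqrtr_sqr ger0_norm.
Qed.

(** Both directions are recorded, since [joined] is used from and towards a base
point, and the formula for [poincare] is immediate if one of the points is [0]. *)
Lemma joined_disc G c v (x : R) : 0 <= x < 1 ->
  (forall m, unit_disc m -> G (c + m *: v)) ->
  joined G (2^-1 * ln ((1 + x) / (1 - x))) c (c + rscale x v) /\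
  joined G (2^-1 * ln ((1 + x) / (1 - x))) (c + rscale x v) c.
Proof.
move=> x01 hG; have x0 : 0 <= x by case/andP: x01.
have u0 : unit_disc (0 : R[i]).
  by apply: (@unit_disc_real 0); rewrite lexx ltr01.
have ux := unit_disc_real x01.
have Gc : G c by have := hG _ u0; rewrite scale0r addr0.
have hol : holomorphic_disc G (fun m : R[i] => c + m *: v).
  by move=> l ul; split; [exact: line_disc_derivable | exact: hG].
split.
- exists (\sum_(j < 1) poincare (0 : R[i]) (x%:C)%C); last first.
    by rewrite big_ord1 poincare0r.
  exists 1%N, (fun=> 0), (fun=> (x%:C)%C),
    (fun j => if j is 0%N then c else c + rscale x v), (fun _ m => c + m *: v).
  split => //.
  + by split => // -[|j] _ //; exact: hG.
  + by case=> // _; split => //; rewrite scale0r addr0.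
- exists (\sum_(j < 1) poincare (x%:C)%C 0); last first.
    by rewrite big_ord1 poincarer0.
  exists 1%N, (fun=> (x%:C)%C), (fun=> 0),
    (fun j => if j is 0%N then c + rscale x v else c), (fun _ m => c + m *: v).
  split => //.
  + by split => // -[|j] _ //; exact: hG.
  + by case=> // _; split => //; rewrite scale0r addr0.
Qed.

(** The disc of parameter [m |-> c + 2 m (y - c)] reaches [y] at [m = 1/2], which
gives the constant [artanh (1/2) = 1/2 ln 3]; the factor [4] leaves room for the
comparison of [norm1] with the modulus of [m]. *)
Lemma joined_ball G c y (s : R) :
  (forall w, norm1 (w - c) < s -> G w) -> norm1 (y - c) < s / 4 ->
  joined G (2^-1 * ln 3) c y /\ joined G (2^-1 * ln 3) y c.
Proof.
move=> hG yc; pose v := rscale 2 (y - c).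
have half : 0 <= (2^-1 : R) < 1 by apply/andP; split; lra.
have hy : c + rscale 2^-1 v = y.
  rewrite /v -[RHS](subrK c) addrC; congr (_ + _); apply: rcoord_inj => a.
  by rewrite !rcoord_rscale mulrA mulVf ?mul1r ?pnatr_eq0.
have e3 : (1 + 2^-1) / (1 - 2^-1) = 3 :> R by field.
have := @joined_disc G c v _ half; rewrite hy e3; apply => m um.
apply: hG; rewrite addrAC subrr add0r.
apply: (le_lt_trans (norm1_scale _ _)).
have hm : `|complex.Re m| + `|complex.Im m| <= 2.
  by apply: (le_trans (re_im_le_cmod m)); move: um; rewrite /unit_disc /=; lra.
rewrite /v norm1_rscale [`|2|]ger0_norm //.
apply: (@le_lt_trans _ _ (2 * (2 * norm1 (y - c)))); last by lra.
by rewrite ler_wpM2r // mulr_ge0 ?norm1_ge0.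
Qed.

End Chains.

(** * Mean value and Taylor estimates *)

Section MeanValue.
Context {R : realType} {n : nat}.
Local Notation Cn := 'rV[R[i]]_n.
Implicit Types (z w v y c h : Cn) (f : Cn -> R) (a : 'I_n * bool).

Lemma alongE a f z (t : R) : along a f z t = f (z + rscale t (direction a)).
Proof. by []. Qed.

Lemma rscaleDl s t v : rscale (s + t) v = rscale s v + rscale t v :> Cn.
Proof. by apply: rcoord_inj => a; rewrite rcoordD !rcoord_rscale mulrDl. Qed.

Lemma along_is_derive a f z (t : R) :
  derivable (along a f (z + rscale t (direction a))) 0 1 ->
  is_derive t 1 (along a f z) (rpartial a f (z + rscale t (direction a))).
Proof.
set z' := z + _ => d.
have sh (h : R) : along a f z (h + t) = along a f z' h.
  by rewrite /along /z' -addrA -rscaleDl [t + h]addrC.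
have e : (fun h : R => h^-1 *: (along a f z (h%:A + t) - along a f z t)) =
         (fun h : R => h^-1 *: (along a f z' (h%:A + 0) - along a f z' 0)).
  by apply/funext => h; rewrite sh -{1}[t]add0r sh addr0.
apply: DeriveDef; first by rewrite /derivable e.
rewrite /rpartial derive1E /derive.
exact: (congr1 (fun g : R -> R => lim (g h @[h --> 0^'])) e).
Qed.

Lemma mvt_direction a f z (t : R) :
  (forall u, `|u| <= `|t| -> derivable (along a f (z + rscale u (direction a))) 0 1) ->
  exists2 u, `|u| <= `|t| &
    f (z + rscale t (direction a)) - f z = t * rpartial a f (z + rscale u (direction a)).
Proof.
move=> hd.
pose df u := rpartial a f (z + rscale u (direction a)).
have hD (u : R) : `|u| <= `|t| -> is_derive u 1 (along a f z) (df u).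
  by move=> ut; apply: along_is_derive; apply: hd.
have hc (u : R) : `|u| <= `|t| -> {for u, continuous (along a f z)}.
  move=> ut; apply: differentiable_continuous; apply/derivable1_diffP.
  by have [] := hD u ut.
have e0 : f z = along a f z 0 by rewrite alongE rscale0 addr0.
rewrite -alongE e0; case: (leP 0 t) => t0.
- have hu (u : R) : 0 <= u <= t -> `|u| <= `|t|.
    by move=> /andP[u0 ut]; rewrite !ger0_norm.
  have dI (u : R) : u \in `]0, t[%R -> is_derive u 1 (along a f z) (df u).
    rewrite in_itv /= => /andP[u0 ut]; apply: hD; apply: hu.
    by apply/andP; split; exact: ltW.
  have cI : {within [set` `[0, t]], continuous (along a f z)}.
    apply: continuous_in_subspaceT => u; rewrite inE /= in_itv /= => h.
    by apply: hc; exact: hu.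
  have [u] := MVT_segment t0 dI cI.
  by rewrite in_itv /= => h e; exists u; [exact: hu | rewrite e subr0 mulrC].
- have hu (u : R) : t <= u <= 0 -> `|u| <= `|t|.
    by move=> /andP[ut u0]; rewrite !ler0_norm ?lerN2 // ltW.
  have dI (u : R) : u \in `]t, 0[%R -> is_derive u 1 (along a f z) (df u).
    rewrite in_itv /= => /andP[u0 ut]; apply: hD; apply: hu.
    by apply/andP; split; exact: ltW.
  have cI : {within [set` `[t, 0]], continuous (along a f z)}.
    apply: continuous_in_subspaceT => u; rewrite inE /= in_itv /= => h.
    by apply: hc; exact: hu.
  have [u] := MVT_segment (ltW t0) dI cI.
  rewrite in_itv /= => h e; exists u; first exact: hu.
  by rewrite -opprB e sub0r mulrN opprK mulrC.
Qed.

(** The common source of the Lipschitz and Taylor estimates: if the partial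
derivatives of [f] differ from the numbers [p a] by at most [e] near [c], then [f]
differs from the affine function of slope [p] by at most [e] times the distance.
The increment is split into steps along the coordinate directions, with the mean
value theorem in one real variable for each step, so that only partial derivatives
are involved. *)
Lemma linear_approx f c h (p : 'I_n * bool -> R) (e : R) :
  (forall a y, norm1 (y - c) <= norm1 h ->
     derivable (along a f y) 0 1 /\ `|rpartial a f y - p a| <= e) ->
  `|f (c + h) - f c - \sum_a p a * rcoord a h| <= e * norm1 h.
Proof.
move=> hf.
pose vec s := \sum_(a <- s) rscale (rcoord a h) (direction a).
pose len s := \sum_(a <- s) `|rcoord a h|.
have vec_len s : norm1 (vec s) <= len s.
  rewrite /vec /len; elim: s => [|a s ih]; first by rewrite !big_nil norm1_0.
  rewrite !big_cons; apply: (le_trans (norm1D _ _)); apply: lerD => //.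
  by rewrite norm1_rscale norm1_direction mulr1.
have main s : len s <= norm1 h ->
    `|f (c + vec s) - f c - \sum_(a <- s) p a * rcoord a h| <= e * len s.
  elim: s => [|a s ih].
    by rewrite /vec /len !big_nil addr0 subrr subr0 normr0 mulr0.
  rewrite [in X in X -> _]/len big_cons -/(len s) => ls.
  have ls' : len s <= norm1 h by apply: le_trans ls; rewrite lerDr.
  have hin (u : R) : `|u| <= `|rcoord a h| ->
      norm1 (c + vec s + rscale u (direction a) - c) <= norm1 h.
    move=> ut; rewrite -[X in X - c]addrA [c + _]addrC addrK.
    apply: (le_trans (norm1D _ _)); apply: le_trans ls.
    by rewrite norm1_rscale norm1_direction mulr1 addrC lerD.
  have [u ut eu] := mvt_direction (fun u hu => (hf a _ (hin u hu)).1).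
  rewrite /vec big_cons -/(vec s) [rscale _ _ + _]addrC addrA.
  rewrite big_cons /len big_cons -/(len s).
  have [_ hp] := hf a _ (hin u ut).
  have hi := ih ls'.
  set A := f (c + vec s + _) in eu *; set B := f (c + vec s) in eu hi *.
  set S := \sum_(j <- s) _ in hi *; set q := rpartial _ _ _ in eu hp.
  have -> : A - f c - (p a * rcoord a h + S) =
            rcoord a h * (q - p a) + (B - f c - S).
    by rewrite mulrBr -eu; ring.
  rewrite [leRHS]mulrDr; apply: (le_trans (ler_normD _ _)); apply: lerD => //.
  by rewrite normrM mulrC ler_wpM2r.
have := main (index_enum _) (lexx _).
by rewrite /vec -rcoord_decomp.
Qed.

Lemma lipschitz_norm1 f c h (M : R) :
  (forall a y, norm1 (y - c) <= norm1 h ->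
     derivable (along a f y) 0 1 /\ `|rpartial a f y| <= M) ->
  `|f (c + h) - f c| <= M * norm1 h.
Proof.
move=> hf; have := @linear_approx f c h (fun=> 0) M.
rewrite big1 ?subr0; last by move=> a _; rewrite mul0r.
by apply => a y /(hf a)[? ?]; rewrite subr0.
Qed.

Lemma taylor1_norm1 f c h (M : R) : 0 <= M ->
  (forall a y, norm1 (y - c) <= norm1 h ->
     derivable (along a f y) 0 1 /\
     forall b, derivable (along b (rpartial a f) y) 0 1 /\
               `|rpartial b (rpartial a f) y| <= M) ->
  `|f (c + h) - f c - \sum_a rpartial a f c * rcoord a h| <= M * norm1 h ^+ 2.
Proof.
move=> M0 hf; rewrite expr2 mulrA; apply: linear_approx => a y yc.
split; first by have [] := hf a y yc.
have -> : y = c + (y - c) by rewrite addrC subrK.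
apply: (@le_trans _ _ (M * norm1 (y - c))); last by rewrite ler_wpM2l.
apply: lipschitz_norm1 => b w wy; have wc := le_trans wy yc.
by have [_] := hf a w wc.
Qed.

End MeanValue.

(** * Uniformity over compact sets *)

Section Compactness.
Context {R : realType} {n : nat}.
Local Notation Cn := 'rV[R[i]]_n.

Lemma invf_le (e M : R) : 0 < e -> e^-1 <= M -> M^-1 <= e.
Proof.
move=> e0 eM; rewrite invf_ple // ?posrE //.
by apply: lt_le_trans eM; rewrite invr_gt0.
Qed.

(** With a bound [M] and a closeness [M^-1] expressed by one large parameter, all the
constants of a local statement become uniform in a single covering argument. *)
Lemma compact_large (K : set Cn) (P : R -> Cn -> Prop) : compact K ->
  (forall x, K x -> exists M s : R, 0 < s /\
     forall M' y, M <= M' -> norm1 (y - x) < s -> P M' y) ->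
  exists2 M : R, 0 < M & forall M' y, M <= M' -> K y -> P M' y.
Proof.
move=> /compact_near_coveringP cK hP.
have := cK R (pinfty_nbhs R) P _; case.
  move=> x Kx; have [M [s [s0 h]]] := hP x Kx.
  exists ([set y | norm1 (y - x) < s], [set M' | M < M']).
    split; first exact: near_norm1.
    by exists M; split => //; exact: num_real.
  by move=> [y M'] [/= ys MM]; apply: h => //; exact: ltW.
move=> M [_ hM]; exists (Num.max M 0 + 1).
  by rewrite ltr_pwDr // le_max lexx orbT.
move=> M' y MM Ky; apply: hM => //; apply: lt_le_trans MM.
by rewrite ltr_pwDr // le_max lexx.
Qed.

Lemma compact_norm1_bounded (K : set Cn) : compact K ->
  exists2 M : R, 0 < M & forall y, K y -> norm1 y < M.
Proof.
move=> cK; have [] := @compact_large K (fun M y => norm1 y < M) cK.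
  move=> x Kx; exists (norm1 x + 1), 1; split => // M' y MM yx.
  have := norm1_tri x y 0; rewrite !subr0; lra.
by move=> M M0 h; exists M => // y Ky; apply: h (lexx _) Ky.
Qed.

Lemma complex_continuous : continuous (fun x : R * R => (x.1 +i* x.2)%C).
Proof.
move=> [x y] A /nbhs_ballP[e e0 he].
have [e'0 ee] := complex_gt0 e0.
set d := complex.Re e in e'0 ee.
apply/nbhs_ballP; exists (d / 2); first by rewrite /= divr_gt0.
move=> [u v] [/=]; rewrite -!ball_normE /= => xu yv.
apply: he; rewrite -ball_normE /ball_ /= ee ltcR.
apply: (le_lt_trans (@cmod_le_re_im R (Complex (x - u) (y - v)))) => /=; lra.
Qed.

(** A closed cube is the power of a closed square of [R[i]], itself the continuous
image of a square of [R * R]. *)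
Lemma compact_cube (M : R) :
  compact [set z : Cn | forall a, `|rcoord a z| <= M].
Proof.
pose Q := [set (x.1 +i* x.2)%C | x in `[- M, M] `*` `[- M, M]] : set R[i].
have cQ : compact Q.
  apply: continuous_compact.
    by apply: continuous_subspaceT; exact: complex_continuous.
  by apply: compact_setX; exact: segment_compact.
have := @rV_compact R[i] n (fun=> Q) (fun=> cQ); congr compact.
apply/seteqP; split => z /= hz.
- move=> [k b]; have [[x y] [/= + +] e] := hz k.
  by rewrite !in_itv /= /rcoord /= -e -!ler_norml => hx hy; case: b.
- move=> k; exists (rcoord (k, false) z, rcoord (k, true) z).
    by split; rewrite /= in_itv /= -ler_norml.
  by rewrite /rcoord /=; case: (z _ _).
Qed.

End Compactness.

(** * Domains with close defining functions *)

Section Closeness.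
Context {R : realType} {n : nat}.
Local Notation Cn := 'rV[R[i]]_n.
Implicit Types (z w v y : Cn) (G U L : set Cn) (r f g : Cn -> R).

Lemma C2norm_lt U f (e : R) : (C2norm U f < e%:E)%E ->
  forall z, U z -> [/\ `|f z| < e, forall a, `|rpartial a f z| < e &
    forall a b, `|rpartial b (rpartial a f) z| < e].
Proof.
rewrite /C2norm !gt_max => /and3P[h0 h1 h2] z Uz.
have sup g : (supnorm U g < e%:E)%E -> `|g z| < e.
  move=> hg; rewrite -lte_fin; apply: le_lt_trans hg.
  by apply: ereal_sup_ubound; exists z.
split; first exact: sup.
- move=> a; apply: sup; apply: le_lt_trans h1.
  exact: (le_bigmax _ (fun a => supnorm U (rpartial a f))).
- move=> a b; apply: sup; apply: le_lt_trans h2.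
  apply: (@le_trans _ _ (\big[maxe/0%E]_b supnorm U (rpartial b (rpartial a f)))).
    exact: (le_bigmax _ (fun b => supnorm U (rpartial b (rpartial a f)))).
  exact: (le_bigmax _ (fun a => \big[maxe/0%E]_b supnorm U (rpartial b (rpartial a f)))).
Qed.

Lemma near_line U z v : open U -> U z -> \forall t \near (0 : R), U (z + rscale t v).
Proof.
move=> oU Uz; have := @line_continuous R n z v 0; apply.
by rewrite rscale0 addr0; exact: open_nbhs_nbhs.
Qed.

Lemma rpartialB f g a z :
  derivable (along a f z) 0 1 -> derivable (along a g z) 0 1 ->
  rpartial a (fun z => f z - g z) z = rpartial a f z - rpartial a g z.
Proof.
by move=> df dg; rewrite /rpartial !derive1E -(deriveB df dg).
Qed.

Lemma rpartial_eq U f g a z : open U -> U z -> (forall y, U y -> f y = g y) ->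
  rpartial a f z = rpartial a g z.
Proof.
move=> oU Uz fg; rewrite /rpartial !derive1E; apply: near_eq_derive.
apply: filterS (near_line (direction a) oU Uz) => t Ut.
by rewrite !alongE fg.
Qed.

(** The derivatives of a difference are the differences of the derivatives; for
the second order this requires the first-order identity on the open set [U], not
only at the point. *)
Lemma C2norm_lt_sub U f g (e : R) : open U -> C2_on U f -> C2_on U g ->
  (C2norm U (fun z => (f z - g z)%R) < e%:E)%E ->
  forall z, U z -> [/\ `|f z - g z| < e,
    forall a, `|rpartial a f z - rpartial a g z| < e &
    forall a b, `|rpartial b (rpartial a f) z - rpartial b (rpartial a g) z| < e].
Proof.
move=> oU [[cf df] d2f] [[cg dg] d2g] /C2norm_lt h z Uz.
have [h0 h1 h2] := h z Uz; split => //.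
- move=> a; have := h1 a; rewrite rpartialB //.
    by have [] := df a z Uz.
  by have [] := dg a z Uz.
- move=> a b; have := h2 a b.
  rewrite (@rpartial_eq U _ (fun y => rpartial a f y - rpartial a g y)) //.
    rewrite rpartialB //.
      by have [_ /(_ b z Uz)[]] := d2f a.
    by have [_ /(_ b z Uz)[]] := d2g a.
  move=> y Uy; rewrite rpartialB //.
    by have [] := df a y Uy.
  by have [] := dg a y Uy.
Qed.

(** For fixed [U], [L], [r0], these are the basic neighbourhoods, with radius [e],
of the C^2 topology on domains. Requiring the boundaries to stay in one set [L],
later compact in [U], is what makes the estimates uniform. *)
Definition close_to U L r0 (e : R) (G : set Cn) (r : Cn -> R) :=
  [/\ bounded_domain G, boundary G `<=` L, defining_function G U r
    & (C2norm U (fun z => (r z - r0 z)%R) < e%:E)%E].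

Lemma close_to_le U L r0 e e' G r : e <= e' ->
  close_to U L r0 e G r -> close_to U L r0 e' G r.
Proof. by move=> ee [? ? ? h]; split => //; apply: lt_le_trans h _; rewrite lee_fin. Qed.

Lemma close_to_sub U L r0 e G r : C2_on U r0 -> close_to U L r0 e G r ->
  forall z, U z -> [/\ `|r z - r0 z| < e,
    forall a, `|rpartial a r z - rpartial a r0 z| < e &
    forall a b, `|rpartial b (rpartial a r) z - rpartial b (rpartial a r0) z| < e].
Proof.
by move=> C0 [_ _ [[oU _] C _ _ _] h]; apply: C2norm_lt_sub.
Qed.

End Closeness.

(** * Balls, closures and bounded domains *)

Section Stability.
Context {R : realType} {n : nat}.
Local Notation Cn := 'rV[R[i]]_n.
Implicit Types (z w v y q : Cn) (G A B : set Cn) (r : Cn -> R).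

Lemma norm1_ball_convex q z y (s t : R) : 0 <= t <= 1 ->
  norm1 (z - q) < s -> norm1 (y - q) < s -> norm1 (z + rscale t (y - z) - q) < s.
Proof.
move=> /andP[t0 t1] hz hy.
have -> : z + rscale t (y - z) - q = rscale (1 - t) (z - q) + rscale t (y - q).
  apply: rcoord_inj => a; rewrite !(rcoordB, rcoordD, rcoord_rscale); ring.
apply: (le_lt_trans (norm1D _ _)); rewrite !norm1_rscale.
rewrite [`|t|]ger0_norm // ger0_norm ?subr_ge0 //.
apply: (@le_lt_trans _ _ (Num.max (norm1 (z - q)) (norm1 (y - q)))).
  set m := Num.max _ _.
  have h1 : norm1 (z - q) <= m by rewrite le_max lexx.
  have h2 : norm1 (y - q) <= m by rewrite le_max lexx orbT.
  have := ler_wpM2l t0 h2; have : 0 <= 1 - t by rewrite subr_ge0.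
  by move=> t1'; have := ler_wpM2l t1' h1; lra.
by rewrite gt_max hz.
Qed.

(** A segment from [z] to a point outside [G] would cross the boundary, and it stays
in the ball by convexity. *)
Lemma ball_avoiding_boundary G q z y (s : R) :
  (forall w, norm1 (w - q) < s -> ~ boundary G w) ->
  norm1 (z - q) < s -> norm1 (y - q) < s -> G z -> G y.
Proof.
move=> hb hz hy Gz; apply: contrapT => Gy.
have [t [t01]] := segment_boundary Gz Gy.
by apply: hb; exact: norm1_ball_convex.
Qed.

Lemma open_norm1 G z : open G -> G z ->
  exists2 s : R, 0 < s & forall w, norm1 (w - z) < s -> G w.
Proof. by move=> oG Gz; apply/nbhs_norm1; exact: open_nbhs_nbhs. Qed.

Lemma continuous_norm1 (f : Cn -> R) z (e : R) : {for z, continuous f} -> 0 < e ->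
  exists2 s : R, 0 < s & forall w, norm1 (w - z) < s -> `|f w - f z| < e.
Proof.
move=> cf e0; apply/nbhs_norm1.
apply: (cf [set y | `|y - f z| < e]); apply/nbhs_ballP.
by exists e => // y; rewrite -ball_normE /= distrC.
Qed.

Lemma closed_avoid A z : closed A -> ~ A z ->
  exists2 s : R, 0 < s & forall w, norm1 (w - z) < s -> ~ A w.
Proof. by move=> cA nA; apply: (@open_norm1 (~` A)) => //; exact: closed_openC. Qed.

Lemma closure_norm1 A z (s : R) : closure A z -> 0 < s ->
  exists2 w, A w & norm1 (w - z) < s.
Proof.
by move=> cA s0; have [w [? ?]] := cA _ (near_norm1 z s0); exists w.
Qed.

Lemma bounded_boundary_nonempty G : (0 < n)%N -> bounded_domain G -> boundary G !=set0.
Proof.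
move=> n0 [[_ _ [z Gz]] [M hM]].
pose y := rscale (M + 1) (direction (Ordinal n0, false)) : Cn.
have Gy : ~ G y.
  move=> /hM; have := cmod_le_enorm y (Ordinal n0).
  have -> : y ord0 (Ordinal n0) = ((M + 1)%:C)%C.
    by rewrite /y /rscale /direction /= scale1r !mxE !eqxx mulr1.
  rewrite /cmod /= expr0n addr0 sqrtr_sqr => h1 h2.
  have := le_trans h1 h2; have := ler_norm (M + 1); lra.
by have [t [_ bt]] := segment_boundary Gz Gy; exists (z + rscale t (y - z)).
Qed.

(** From a point of [G] outside the ball, the ray pointing away from the origin
would leave the bounded set [G] through a boundary point that is even farther. *)
Lemma bounded_domain_norm1 G (M : R) : 0 < M -> bounded_domain G ->
  (forall z, boundary G z -> norm1 z < M) -> forall z, G z -> norm1 z < M.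
Proof.
move=> M0 [_ [B hB]] hM z Gz; rewrite ltNge; apply/negP => Mz.
have z0 : 0 < norm1 z := lt_le_trans M0 Mz.
pose s := 1 + `|2 * n%:R * B| / norm1 z.
have s1 : 1 <= s by rewrite lerDl divr_ge0 // ltW.
have Gy : ~ G (rscale s z).
  move=> /hB hy; have := norm1_le_enorm (rscale s z).
  rewrite norm1_rscale ger0_norm; last by lra.
  rewrite /s mulrDl mul1r divfK ?gt_eqF // => h.
  have := ler_wpM2l (mulr_ge0 (ler0n R 2) (ler0n R n)) hy => h'.
  by have := ler_norm (2 * n%:R * B); lra.
have [t [/andP[t0 t1] bt]] := segment_boundary Gz Gy.
have := hM _ bt.
have -> : z + rscale t (rscale s z - z) = rscale (1 + t * (s - 1)) z.
  by apply: rcoord_inj => a; rewrite !(rcoordB, rcoordD, rcoord_rscale); ring.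
have h1 : 1 <= 1 + t * (s - 1) by rewrite lerDl mulr_ge0 // subr_ge0.
rewrite norm1_rscale ger0_norm; last by lra.
have := ler_wpM2r (ltW z0) h1; lra.
Qed.

End Stability.

(** * Points far from the boundary *)

Section Family.
Context {R : realType} {n : nat}.
Local Notation Cn := 'rV[R[i]]_n.
Implicit Types (z w v y q : Cn) (G A B : set Cn) (r : Cn -> R).
Context (U L G0 : set Cn) (r0 : Cn -> R).
Context (n0 : (0 < n)%N) (cL : compact L) (LU : L `<=` U).
Context (bG0 : bounded_domain G0) (LG0 : boundary G0 `<=` L).
Context (dG0 : defining_function G0 U r0).

Let oU : open U. Proof. by case: dG0 => -[]. Qed.
Let oG0 : open G0. Proof. by case: bG0 => -[]. Qed.
Let C2r0 : C2_on U r0. Proof. by case: dG0. Qed.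
Let cr0 z : U z -> {for z, continuous r0}. Proof. by case: C2r0 => -[+ _ _]; apply. Qed.
Let clL : closed L.
Proof. by apply: compact_closed => //; exact: norm_hausdorff. Qed.

Definition stable_at z := exists e s : R, [/\ 0 < e, 0 < s &
  forall G r w, close_to U L r0 e G r -> norm1 (w - z) < s -> (G w <-> G0 w)].

Lemma stable_sign z : U z -> r0 z != 0 -> stable_at z.
Proof.
move=> Uz rz; have e0 : 0 < `|r0 z| / 2 by rewrite divr_gt0 ?normr_gt0.
have [s1 s10 h1] := open_norm1 oU Uz.
have [s2 s20 h2] := continuous_norm1 (cr0 Uz) e0.
exists (`|r0 z| / 2), (Num.min s1 s2); split => //; first by rewrite lt_min s10.
move=> G r w cG; rewrite lt_min => /andP[/h1 Uw /h2 hw].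
have [hr _ _] := close_to_sub C2r0 cG Uw.
have [_ _ dG _] := cG.
rewrite (defining_in dG Uw) (defining_in dG0 Uw).
move: hr hw; rewrite !ltr_norml => /andP[a1 a2] /andP[b1 b2].
case: (ltrgtP (r0 z) 0) => h; last by rewrite h eqxx in rz.
  by rewrite (ltr0_norm h) in a1 a2 b1 b2; split; lra.
by rewrite (gtr0_norm h) in a1 a2 b1 b2; split; lra.
Qed.

(** The defining functions only see [U]; the information is propagated to the
rest of the space by connectedness. The set of points which belong to [U] or are
stable has no boundary point [q]: if [q] is in [L], then [U] is a neighbourhood of
[q]; otherwise some ball around [q] avoids [L], hence all boundaries, and on such a
ball membership in [G] and in [G0] is decided at a single stable point. *)
Lemma covered_or_stable z : U z \/ stable_at z.
Proof.
apply: contrapT => nz; pose A := [set z | U z \/ stable_at z].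
have [u bu] := bounded_boundary_nonempty n0 bG0.
have Au : A u by left; apply: LU; exact: LG0.
have [t [_ [clq nq]]] := @segment_boundary _ _ A u z Au nz.
set q := u + _ in clq nq; apply: nq.
have [Lq|nLq] := pselect (L q).
  apply: (@filterS _ _ _ U) => [w Uw|]; first by left.
  by apply: open_nbhs_nbhs; split => //; exact: LU.
have [s s0 hs] := closed_avoid clL nLq.
have [a Aa qa] := closure_norm1 clq s0.
have [e [s' [e0 s'0 hst]]] : stable_at a.
  case: Aa => // Ua; apply: stable_sign => //; apply/eqP => ra.
  by apply: (hs a qa); apply: LG0; exact: (defining_boundary oG0 dG0).
apply/nbhs_norm1; exists s => // w ws; right.
have sw0 : 0 < s - norm1 (w - q) by rewrite subr_gt0.
exists e, (s - norm1 (w - q)); split => // G r w' cG w'w.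
have w's : norm1 (w' - q) < s by have := norm1_tri w w' q; lra.
have hG y : norm1 (y - q) < s -> ~ boundary G y.
  by move=> ys by_; apply: (hs y ys); case: cG => _ + _ _; exact.
have hG0 y : norm1 (y - q) < s -> ~ boundary G0 y.
  by move=> ys by_; apply: (hs y ys); exact: LG0.
have aa : norm1 (a - a) < s' by rewrite subrr norm1_0.
have [h1 h2] := hst G r a cG aa; split => hw.
  exact: (ball_avoiding_boundary hG0 qa w's (h1 (ball_avoiding_boundary hG w's qa hw))).
exact: (ball_avoiding_boundary hG qa w's (h2 (ball_avoiding_boundary hG0 w's qa hw))).
Qed.

Lemma stable_off_boundary z : ~ boundary G0 z -> stable_at z.
Proof.
move=> nb; case: (covered_or_stable z) => // Uz; apply: stable_sign => //.
by apply/eqP => rz; apply: nb; exact: (defining_boundary oG0 dG0).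
Qed.

Lemma stable_inside z : G0 z -> exists e s : R, [/\ 0 < e, 0 < s &
  forall G r w, close_to U L r0 e G r -> norm1 (w - z) < s -> G w].
Proof.
move=> Gz; have [e [s [e0 s0 h]]] : stable_at z.
  by apply: stable_off_boundary => bz; exact: (boundary_notin oG0 bz).
have [s' s'0 h'] := open_norm1 oG0 Gz.
exists e, (Num.min s s'); split => //; first by rewrite lt_min s0.
by move=> G r w cG; rewrite lt_min => /andP[ws /h' Gw]; apply/(h G r w).
Qed.

Lemma stable_outside z : ~ G0 z -> ~ boundary G0 z -> exists e s : R, [/\ 0 < e, 0 < s &
  forall G r w, close_to U L r0 e G r -> norm1 (w - z) < s -> ~ G w].
Proof.
move=> nG nb; have [e [s [e0 s0 h]]] := stable_off_boundary nb.
have ncl : ~ closure G0 z.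
  by move=> cz; apply: nb; split=> // iz; apply: nG; exact: interior_subset iz.
have [s' s'0 h'] := closed_avoid (@closed_closure _ G0) ncl.
exists e, (Num.min s s'); split => //; first by rewrite lt_min s0.
move=> G r w cG; rewrite lt_min => /andP[ws w's] Gw; apply: (h' w w's).
by apply: subset_closure; apply/(h G r w).
Qed.

Definition uniformly_joined b z := exists e s C : R, [/\ 0 < e, 0 < s &
  forall G r w, close_to U L r0 e G r -> norm1 (w - z) < s ->
    joined G C b w /\ joined G C w b].

(** The set of good points is open by definition; it is closed in [G0] because a
small ball around a limit point lies in all close domains, which allows one more
disc. *)
Lemma uniformly_joined_all b z : G0 b -> G0 z -> uniformly_joined b z.
Proof.
move=> Gb; pose B := [set w | G0 w /\ uniformly_joined b w].
have hB : B = G0.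
  case: bG0 => -[_ cG _] _; apply: cG.
  - exists b; split => //; have [e [s [e0 s0 h]]] := stable_inside Gb.
    exists e, (s / 4), (2^-1 * ln 3); split => //; first by rewrite divr_gt0.
    move=> G r w cG; apply: (@joined_ball _ _ G b w s) => y; exact: (h G r).
  - exists (interior (uniformly_joined b)); first exact: open_interior.
    apply/seteqP; split => w [Gw]; last first.
      by move=> /interior_subset rw; split.
    move=> [e [s [C [e0 s0 h]]]]; split => //.
    apply/nbhs_norm1; exists (s / 2); first by rewrite divr_gt0.
    move=> y yw; exists e, (s / 2), C; split => //; first by rewrite divr_gt0.
    move=> G r x cG xy; apply: (h G r) => //.
    by have := norm1_tri y x w; lra.
  - exists (closure B); first exact: closed_closure.
    apply/seteqP; split => w [Gw]; first by move=> rw; split => //; exact: subset_closure.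
    move=> clw; split => //; have [e [s [e0 s0 h]]] := stable_inside Gw.
    have s16 : 0 < s / 16 by rewrite divr_gt0.
    have [a [Ga [e' [s' [C [e'0 s'0 h']]]]] aw] := closure_norm1 clw s16.
    exists (Num.min e e'), (s / 16), (C + 2^-1 * ln 3).
    split => //; first by rewrite lt_min e0.
    move=> G r y cG yw.
    have ceG : close_to U L r0 e G r by apply: close_to_le cG; rewrite ge_min lexx.
    have ceG' : close_to U L r0 e' G r by apply: close_to_le cG; rewrite ge_min lexx orbT.
    have [j1 j2] : joined G (2^-1 * ln 3) a y /\ joined G (2^-1 * ln 3) y a.
      apply: (@joined_ball _ _ G a y (s / 2)).
        move=> x xa; apply: (h G r) => //; have := norm1_tri a x w; lra.
      have := norm1_tri w y a; rewrite (norm1_sym w a); lra.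
    have aa : norm1 (a - a) < s' by rewrite subrr norm1_0.
    have [i1 i2] := h' G r a ceG' aa; split; first exact: joined_trans i1 j1.
    by rewrite addrC; exact: joined_trans j2 i2.
by rewrite -{1}hB => -[].
Qed.

Lemma joined_compact b K : G0 b -> compact K -> K `<=` G0 ->
  exists2 M : R, 0 < M & forall G r w, close_to U L r0 M^-1 G r -> K w ->
    joined G M b w /\ joined G M w b.
Proof.
move=> Gb cK KG.
have [|M M0 h] := @compact_large _ _ K (fun M w => forall G r,
   close_to U L r0 M^-1 G r -> joined G M b w /\ joined G M w b) cK.
  move=> w Kw; have [e [s [C [e0 s0 h]]]] := uniformly_joined_all Gb (KG _ Kw).
  exists (Num.max C e^-1), s; split => // M y; rewrite ge_max => /andP[CM eM] yw G r cG.
  have [|j1 j2] := h G r y _ yw; last by split; apply: joined_le CM _.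
  by apply: close_to_le cG; exact: invf_le.
by exists M => // G r w cG Kw; apply: h (lexx _) Kw G r cG.
Qed.

(** All the domains [G] lie in a fixed cube, which is covered by neighbourhoods of
points of [G0], where [uniformly_joined_all] applies, and of boundary and exterior
points of [G0], near which no [w] satisfies the hypotheses if [G] is close to [G0]:
near a boundary point [r] is larger than [- k]. *)
Lemma joined_deep b (k d : R) : G0 b -> 0 < k -> 0 < d ->
  exists2 M : R, 0 < M & forall G r w, close_to U L r0 M^-1 G r ->
    G w -> (forall l, L l -> norm1 (w - l) < d -> r w <= - k) ->
    joined G M b w /\ joined G M w b.
Proof.
move=> Gb k0 d0; have [D D0 hD] := compact_norm1_bounded cL.
have [|M M0 h] := @compact_large _ _ _ (fun M w => forall G r,
   close_to U L r0 M^-1 G r -> G w ->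
   (forall l, L l -> norm1 (w - l) < d -> r w <= - k) ->
   joined G M b w /\ joined G M w b) (@compact_cube R n D).
  move=> w _.
  have [Gw|nGw] := pselect (G0 w).
    have [e [s [C [e0 s0 h]]]] := uniformly_joined_all Gb Gw.
    exists (Num.max C e^-1), s; split => // M y; rewrite ge_max => /andP[CM eM] yw G r cG _ _.
    have [|j1 j2] := h G r y _ yw; last by split; apply: joined_le CM _.
    by apply: close_to_le cG; exact: invf_le.
  have [bw|nbw] := pselect (boundary G0 w).
    have [Uw rw] := defining_zero oG0 dG0 bw.
    have k2 : 0 < k / 2 by rewrite divr_gt0.
    have [s1 s10 h1] := open_norm1 oU Uw.
    have [s2 s20 h2] := continuous_norm1 (cr0 Uw) k2.
    exists (k / 2)^-1, (Num.min d (Num.min s1 s2)).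
    split; first by rewrite !lt_min d0 s10.
    move=> M y kM; rewrite !lt_min => /and3P[yd /h1 Uy /h2 hy] G r cG _.
    move=> /(_ w (LG0 bw) yd) ry.
    exfalso; have [hr _ _] := close_to_sub C2r0 (close_to_le (invf_le k2 kM) cG) Uy.
    by move: hr hy; rewrite rw subr0 !ltr_norml => /andP[a1 a2] /andP[b1 b2]; lra.
  have [e [s [e0 s0 h]]] := stable_outside nGw nbw.
  exists e^-1, s; split => // M y eM yw G r cG Gy _; exfalso.
  by apply: (h G r y _ yw Gy); apply: close_to_le cG; exact: invf_le.
exists M => // G r w cG Gw dw; apply: (h M w (lexx _) _ G r cG Gw dw) => a.
have [bG LG _ _] := cG.
have wD : norm1 w < D.
  by apply: bounded_domain_norm1 D0 bG _ _ Gw => z /LG /hD.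
apply: le_trans (ltW wD); rewrite /norm1 (bigD1 a) //= lerDl.
exact: sumr_ge0.
Qed.

End Family.

(** * The gradient and the distance to the boundary *)

Section Gradient.
Context {R : realType} {n : nat}.
Local Notation Cn := 'rV[R[i]]_n.
Implicit Types (z w v y c q : Cn) (G U : set Cn) (r : Cn -> R).

(** As a vector of C^n the real gradient is twice [dbar r]. *)
Definition grad r w : Cn := \sum_a rscale (rpartial a r w) (direction a).

Definition grad2 r w : R := \sum_a rpartial a r w ^+ 2.

Lemma rcoord_grad r w a : rcoord a (grad r w) = rpartial a r w.
Proof. exact: rcoord_comb. Qed.

Lemma rcoord_pairing v (l : R[i]) :
  \sum_a rcoord a v * rcoord a (l *: v) = complex.Re l * \sum_a rcoord a v ^+ 2.
Proof.
rewrite !sum_directions mulr_sumr; apply: eq_bigr => k _.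
rewrite /rcoord /= !mxE; case: l => s t; case: (v ord0 k) => x y /=.
ring.
Qed.

(** Multiplication by [i] rotates the gradient into its orthogonal complement, so
the imaginary part of [l] disappears at first order. *)
Lemma grad_pairing r w (l : R[i]) :
  \sum_a rpartial a r w * rcoord a (l *: grad r w) = complex.Re l * grad2 r w.
Proof.
have e a : rpartial a r w = rcoord a (grad r w) by rewrite rcoord_grad.
transitivity (\sum_a rcoord a (grad r w) * rcoord a (l *: grad r w)).
  by apply: eq_bigr => a _; congr (_ * _); exact: e.
rewrite rcoord_pairing; congr (_ * _).
by apply: eq_bigr => a _; congr (_ ^+ 2); exact/esym/e.
Qed.

Lemma norm1_grad r w : norm1 (grad r w) = \sum_a `|rpartial a r w|.
Proof. by apply: eq_bigr => a _; rewrite rcoord_grad. Qed.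

Lemma cmod_sqr (l : R[i]) : cmod l ^+ 2 = complex.Re l ^+ 2 + complex.Im l ^+ 2.
Proof. by case: l => x y; rewrite /cmod /= sqr_sqrtr // addr_ge0 // sqr_ge0. Qed.

Lemma eudist_le w A q : A q -> eudist w A <= enorm (w - q).
Proof.
move=> Aq; apply: ge_inf; last by exists q.
by exists 0 => _ [y _ <-]; exact: sqrtr_ge0.
Qed.

(** As [ln 0 = 0] by convention, taking logarithms in an upper bound for the
distance requires the distance to be positive. *)
Lemma eudist_gt0 G w : (0 < n)%N -> open G -> boundary G !=set0 -> G w ->
  0 < eudist w (boundary G).
Proof.
move=> n0 oG [q0 bq0] Gw; have [s s0 hs] := open_norm1 oG Gw.
have N0 : 0 < 2 * n%:R :> R by rewrite mulr_gt0 // ltr0n.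
apply: (@lt_le_trans _ _ (s / (2 * n%:R))); first by rewrite divr_gt0.
apply: lb_le_inf; first by exists (enorm (w - q0)), q0.
move=> _ [q bq <-]; rewrite ler_pdivrMr // mulrC.
apply: le_trans (norm1_le_enorm _); rewrite leNgt; apply/negP => h.
by apply: (boundary_notin oG bq); apply: hs; rewrite norm1_sym.
Qed.

End Gradient.

(** * The disc through a point near the boundary *)

Section Disc.
Context {R : realType} {n : nat}.
Local Notation Cn := 'rV[R[i]]_n.
Implicit Types (z w v y c q : Cn) (G U : set Cn) (r : Cn -> R).

Definition controlled U r (s B : R) w := forall y, norm1 (y - w) < s ->
  [/\ U y, forall a, `|rpartial a r y| <= B
    & forall a b, `|rpartial b (rpartial a r) y| <= B].

Let N : R := \sum_(a : 'I_n * bool) 1.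

(** Here [N * B], with [N] the number of real directions, bounds the gradient; the
factor [4] is the square of the constant in the comparison of [norm1 (l *: v)] with
[cmod l]. *)
Lemma taylor_grad U r (s B : R) w (l : R[i]) : C2_on U r -> 0 < s -> 0 < B ->
  controlled U r s B w -> 2 * cmod l * (N * B) < s ->
  `|r (w + l *: grad r w) - r w - complex.Re l * grad2 r w|
     <= 4 * B * (N * B) ^+ 2 * cmod l ^+ 2.
Proof.
move=> [[_ d1] d2] s0 B0 hc ls.
set h := l *: grad r w.
have hD : norm1 (grad r w) <= N * B.
  rewrite norm1_grad /N mulr_suml; apply: ler_sum => a _; rewrite mul1r.
  by have [|_ + _] := hc w; [rewrite subrr norm1_0 | apply].
have hh : norm1 h <= 2 * cmod l * (N * B).
  apply: (le_trans (norm1_scale _ _)).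
  apply: ler_pM (re_im_le_cmod l) hD; [by rewrite addr_ge0 | exact: norm1_ge0].
have hs : norm1 h < s := le_lt_trans hh ls.
rewrite -grad_pairing -/h; apply: (@le_trans _ _ (B * norm1 h ^+ 2)).
  apply: taylor1_norm1 => [|a y yh]; first exact: ltW.
  have [Uy h1 h2] := hc y (le_lt_trans yh hs).
  split; first by have [] := d1 a y Uy.
  by move=> b; split => //; have [_ /(_ b y Uy)[]] := d2 a.
have -> : 4 * B * (N * B) ^+ 2 * cmod l ^+ 2 = B * (2 * cmod l * (N * B)) ^+ 2 by ring.
by rewrite ler_pM2l // lerXn2r // nnegrE ?norm1_ge0 // (le_trans _ hh) // norm1_ge0.
Qed.

(** With [g] the squared length of the gradient and [eta = - r w], the radius [rho]
is so small that the second-order term in Taylor's formula is at most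
[g |l|^2 / (2 rho)] for [|l| <= 4 rho]. Then
  [r (w + l v) <= - eta + g / (2 rho) * (|l + rho|^2 - rho^2)],
which is negative for [|l + rho| < rho + tau] if [tau] is at most [eta / (2 g)] and
[2 rho]. In the resulting disc [w] has the parameter [rho / (rho + tau)], whose
Poincare distance to [0] is [1/2 ln ((2 rho + tau) / tau)]. *)
Lemma disc_estimate (s B g0 : R) : 0 < s -> 0 < B -> 0 < g0 ->
  exists k C1 C2 : R, [/\ 0 < k, 0 < C1, 0 < C2 &
    forall G U r w, open G -> defining_function G U r -> G w ->
      controlled U r s B w -> g0 <= grad2 r w -> - k < r w ->
      exists c, [/\ U c, G c, r c <= - k,
        joined G (2^-1 * ln (C1 / - r w)) c w
        & eudist w (boundary G) <= C2 * - r w]].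
Proof.
move=> s0 B0 g00.
pose D := N * B + 1; pose A := 4 * B * (N * B) ^+ 2 + 1; pose Q := N * B ^+ 2 + 1.
have N0 : 0 <= N by apply: sumr_ge0.
have D0 : 0 < D by rewrite ltr_wpDl // mulr_ge0 // ltW.
have A0 : 0 < A by rewrite ltr_wpDl // !mulr_ge0 // ?ltW // sqr_ge0.
have Q0 : 0 < Q by rewrite ltr_wpDl // mulr_ge0 // sqr_ge0.
pose rho := Num.min (g0 / (2 * A)) (s / (16 * D)).
have rho0 : 0 < rho by rewrite lt_min !divr_gt0 // mulr_gt0.
have rhoA : 2 * rho * A <= g0.
  have : rho <= g0 / (2 * A) by rewrite ge_min lexx.
  by rewrite ler_pdivlMr ?mulr_gt0 //; lra.
have rhoD : 16 * rho * D <= s.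
  have : rho <= s / (16 * D) by rewrite ge_min lexx orbT.
  by rewrite ler_pdivlMr ?mulr_gt0 //; lra.
exists (g0 * rho / 4), (8 * rho * Q), (4 * D / g0); split.
- by rewrite divr_gt0 ?mulr_gt0.
- by rewrite !mulr_gt0.
- by rewrite divr_gt0 ?mulr_gt0.
move=> G U r w oG dG Gw hc g0g kr.
have [_ C2 _ _ _] := dG.
have hw : norm1 (w - w) < s by rewrite subrr norm1_0.
have [Uw hp _] := hc w hw.
have eta0 : r w < 0 by apply/(defining_in dG Uw).
set eta := - r w; have e0 : 0 < eta by rewrite oppr_gt0.
set v := grad r w; set g := grad2 r w in g0g *.
have gQ : g <= Q.
  apply: (@le_trans _ _ (N * B ^+ 2)); last by rewrite lerDl.
  rewrite /g /grad2 /N mulr_suml; apply: ler_sum => a _; rewrite mul1r.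
  rewrite -(real_normK (num_real (rpartial a r w))).
  by rewrite lerXn2r // ?nnegrE //; exact: ltW.
have gp : 0 < g := lt_le_trans g00 g0g.
have eta_rho : eta < g0 * rho / 4 by rewrite /eta; lra.
have vD : norm1 v <= D.
  rewrite (@le_trans _ _ (N * B)) ?lerDl // norm1_grad /N mulr_suml.
  by apply: ler_sum => a _; rewrite mul1r.
(* Taylor's formula, with the remainder compared to [g |l|^2 / (2 rho)] *)
have key (l : R[i]) : cmod l <= 4 * rho ->
    U (w + l *: v) /\
    `|r (w + l *: v) + eta - complex.Re l * g| * (2 * rho) <= g * cmod l ^+ 2.
  move=> lr.
  have c0 := cmod_ge0 l.
  have lD : 2 * cmod l * D < s.
    apply: lt_le_trans rhoD.
    apply: (@le_lt_trans _ _ (8 * rho * D)); first by rewrite ler_wpM2r ?(ltW D0) //; lra.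
    by rewrite ltr_pM2r //; lra.
  have lNB : 2 * cmod l * (N * B) < s.
    apply: le_lt_trans lD; rewrite ler_wpM2l ?lerDl // mulr_ge0 //.
  split.
    have [] // := hc (w + l *: v).
    rewrite addrAC subrr add0r; apply: (le_lt_trans (norm1_scale _ _)).
    apply: le_lt_trans lD; apply: ler_pM (re_im_le_cmod l) vD; last exact: norm1_ge0.
    by rewrite addr_ge0.
  have := taylor_grad C2 s0 B0 hc lNB; rewrite -/v -/g /eta => ht.
  apply: (@le_trans _ _ (A * cmod l ^+ 2 * (2 * rho))).
    rewrite ler_pM2r ?mulr_gt0 //; apply: (le_trans ht).
    by rewrite ler_wpM2r ?sqr_ge0 // lerDl.
  rewrite mulrAC ler_wpM2r ?sqr_ge0 //; lra.
have in_disc (l : R[i]) : cmod l <= 4 * rho ->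
    2 * rho * complex.Re l + cmod l ^+ 2 < 2 * rho * (eta / g) ->
    G (w + l *: v).
  move=> lr hl; have [Ul hk] := key l lr; apply/(defining_in dG Ul).
  have h1 := ler_norm (r (w + l *: v) + eta - complex.Re l * g).
  have r2 : 0 < 2 * rho by rewrite mulr_gt0.
  have h2 := ler_wpM2r (ltW r2) h1.
  have h3 : g * (2 * rho * complex.Re l + cmod l ^+ 2) < 2 * rho * eta.
    have := hl; rewrite -(ltr_pM2l gp); congr (_ < _).
    by field; rewrite gt_eqF.
  rewrite -(pmulr_llt0 _ r2); lra.
(* [Q] bounds [g], so this [tau] does not depend on the length of the gradient *)
pose tau := eta / (2 * Q).
have t0 : 0 < tau by rewrite divr_gt0 ?mulr_gt0.
have tQ : tau * (2 * Q) = eta by rewrite /tau divfK // gt_eqF // mulr_gt0.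
have t2 : tau < 2 * rho.
  rewrite -(@ltr_pM2r _ (2 * Q)) ?mulr_gt0 // tQ.
  apply: (lt_le_trans eta_rho).
  by have := ler_wpM2l (ltW rho0) (le_trans g0g gQ); have := mulr_gt0 rho0 Q0; lra.
pose sg := rho + tau; have sg0 : 0 < sg by rewrite addr_gt0.
pose c := w - rscale rho v.
have hcl (m : R[i]) : c + m *: rscale sg v = w + (m * (sg%:C)%C - (rho%:C)%C) *: v.
  by rewrite /c /rscale scalerBl scalerA addrAC addrA.
have cmod_real (x : R) : 0 <= x -> cmod (x%:C)%C = x.
  by move=> x0; rewrite /cmod /= expr0n addr0 sqrtr_sqr ger0_norm.
have cmodN (x : R[i]) : cmod (- x) = cmod x by exact: normcN.
have disc (m : R[i]) : unit_disc m -> G (c + m *: rscale sg v).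
  rewrite /unit_disc /= => um; rewrite hcl; set l := _ - _.
  have cl : cmod (m * (sg%:C)%C) < sg.
    have -> : cmod (m * (sg%:C)%C) = cmod m * cmod (sg%:C)%C.
      exact: ComplexField.Normc.normcM.
    by rewrite cmod_real ?(ltW sg0) // gtr_pMl.
  apply: in_disc.
    apply: (@le_trans _ _ (cmod (m * (sg%:C)%C) + cmod (- (rho%:C)%C))).
      exact: le_normcD.
    rewrite cmodN (cmod_real rho) ?(ltW rho0) //.
    by move: cl; rewrite /sg; lra.
  have e : 2 * rho * complex.Re l + cmod l ^+ 2 = cmod (m * (sg%:C)%C) ^+ 2 - rho ^+ 2.
    rewrite !cmod_sqr /l; case: (m * _) => x y /=; ring.
  rewrite e; apply: (@lt_le_trans _ _ (sg ^+ 2 - rho ^+ 2)).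
    by rewrite ltrD2r ltr_pXn2r // ?nnegrE ?cmod_ge0 // ltW.
  apply: (@le_trans _ _ (4 * rho * tau)).
    by rewrite /sg; have := ler_wpM2l (ltW t0) (ltW t2); lra.
  have ht : 2 * tau <= eta / g.
    by rewrite ler_pdivlMr // -tQ; have := ler_wpM2l (ltW t0) gQ; lra.
  have := ler_wpM2l (mulr_ge0 (ler0n R 2) (ltW rho0)) ht; lra.
have u0 : unit_disc (0 : R[i]) by apply: (@unit_disc_real R 0); rewrite lexx ltr01.
have Gc : G c by have := disc 0 u0; rewrite scale0r addr0.
have hrho : c = w + (- (rho%:C)%C) *: v by rewrite scaleNr.
have crho : cmod (- (rho%:C)%C) = rho by rewrite cmodN cmod_real // ltW.
have [Uc hck] : U c /\ r c <= - (g0 * rho / 4).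
  have [] := key (- (rho%:C)%C); first by rewrite crho; lra.
  rewrite -hrho crho => Uc hk; split => //.
  have r2 : 0 < 2 * rho by rewrite mulr_gt0.
  have h1 := ler_norm (r c + eta - complex.Re (- (rho%:C)%C) * g).
  have := le_trans (ler_wpM2r (ltW r2) h1) hk.
  move=> /= hX; have hY : 2 * (r c + eta + rho * g) <= g * rho.
    rewrite -(ler_pM2r rho0); lra.
  have := ler_wpM2l (ltW rho0) g0g; have := mulr_gt0 rho0 g00; lra.
exists c; split => //.
- have x01 : 0 <= rho / sg < 1.
    by rewrite divr_ge0 ?(ltW rho0) ?(ltW sg0) //= ltr_pdivrMr // mul1r ltrDl.
  have [j1 _] := joined_disc x01 disc.
  have ew : c + rscale (rho / sg) (rscale sg v) = w.
    rewrite /c -[RHS](subrK (rscale rho v)); congr (_ + _).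
    apply: rcoord_inj => a; rewrite !rcoord_rscale mulrA divfK // gt_eqF //.
  rewrite ew in j1; apply: joined_le j1.
  rewrite ler_pM2l ?invr_gt0 // ler_ln ?posrE.
  + have -> : (1 + rho / sg) / (1 - rho / sg) = (2 * rho + tau) / tau.
      by rewrite /sg; field; rewrite !gt_eqF //=; lra.
    rewrite ler_pdivrMr //.
    have -> : 8 * rho * Q / eta * tau = 4 * rho.
      by rewrite /tau; field; rewrite !gt_eqF.
    by move: t2; lra.
  + case/andP: x01 => x0 x1; rewrite divr_gt0 //; lra.
  + by rewrite divr_gt0 // !mulr_gt0.
  (* the linear gain [g s'] is at least [4 eta], the quadratic loss at most half of it *)
- pose s' := 4 * eta / g0.
  have s'0 : 0 < s' by rewrite divr_gt0 ?mulr_gt0.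
  have s'g : s' * g0 = 4 * eta by rewrite /s' divfK // gt_eqF.
  have s'r : s' <= rho.
    by rewrite -(ler_pM2r g00) s'g; lra.
  have cs : cmod (s'%:C)%C = s' by rewrite cmod_real // ltW.
  have [] := key (s'%:C)%C; first by rewrite cs; lra.
  rewrite cs => Us hk.
  have nGs : ~ G (w + rscale s' v).
    move=> /(defining_in dG Us); apply/negP; rewrite -leNgt.
    have r2 : 0 < 2 * rho by rewrite mulr_gt0.
    have h1 := ler_norm (- (r (w + (s'%:C)%C *: v) + eta - s' * g)).
    rewrite normrN in h1.
    have := le_trans (ler_wpM2r (ltW r2) h1) hk.
    rewrite -(pmulr_lge0 _ r2) /rscale => h2.
    have h3 : g * s' ^+ 2 <= g * s' * rho.
      by rewrite expr2 mulrA ler_wpM2l // mulr_ge0 // ltW.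
    have h4 : 4 * eta * rho <= s' * g * rho.
      by rewrite -s'g ler_wpM2r ?(ltW rho0) // ler_wpM2l // ltW.
    by have := mulr_gt0 e0 rho0; lra.
  have [t [/andP[t1 t2'] bt]] := segment_boundary Gw nGs.
  apply: (le_trans (eudist_le w bt)); apply: (le_trans (enorm_le_norm1 _)).
  rewrite opprD addrA subrr add0r norm1N [w + _]addrC addrK !norm1_rscale.
  rewrite !ger0_norm ?(ltW s'0) //.
  have -> : 4 * D / g0 * eta = 1 * (s' * D) by rewrite /s'; ring.
  apply: ler_pM => //; first by rewrite mulr_ge0 ?(ltW s'0) ?norm1_ge0.
  by rewrite ler_pM2l.
Qed.

End Disc.

(** * The local estimate *)

Section Uniform.
Context {R : realType} {n : nat}.
Local Notation Cn := 'rV[R[i]]_n.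
Implicit Types (z w v y q : Cn) (G A B : set Cn) (r : Cn -> R).
Context (U L G0 : set Cn) (r0 : Cn -> R).
Context (n0 : (0 < n)%N) (cL : compact L) (LU : L `<=` U).
Context (bG0 : bounded_domain G0) (LG0 : boundary G0 `<=` L).
Context (dG0 : defining_function G0 U r0).

Let oU : open U. Proof. by case: dG0 => -[]. Qed.
Let oG0 : open G0. Proof. by case: bG0 => -[]. Qed.
Let C2r0 : C2_on U r0. Proof. by case: dG0. Qed.

Lemma continuous_bound z (I : finType) (f : I -> Cn -> R) :
  (forall i, {for z, continuous (f i)}) ->
  exists2 s : R, 0 < s & forall y, norm1 (y - z) < s ->
    forall i, `|f i y| <= 1 + \sum_j `|f j z|.
Proof.
move=> cf; apply/nbhs_norm1.
apply: (@filter_forall _ _ (fun i => [set y | `|f i y| <= 1 + \sum_j `|f j z|])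
  (nbhs z) _) => i.
have [s s0 hs] := continuous_norm1 (cf i) (@ltr01 R).
apply/nbhs_norm1; exists s => // y /hs h.
have hi : `|f i z| <= \sum_j `|f j z| by rewrite (bigD1 i) //= lerDl sumr_ge0.
rewrite /=; have := ler_normD (f i y - f i z) (f i z); rewrite subrK; lra.
Qed.

Lemma grad2_ge0 r z : 0 <= grad2 r z.
Proof. by apply: sumr_ge0 => a _; exact: sqr_ge0. Qed.

(** A zero of [r0] on [L] is a boundary point, where the gradient of a defining
function does not vanish. *)
Lemma nondegenerate_near z : L z -> exists s m : R, [/\ 0 < s, 0 < m &
  forall y, norm1 (y - z) < s -> m <= `|r0 y| + grad2 r0 y].
Proof.
move=> Lz; have Uz := LU Lz; have [[c0 d0] d20] := C2r0.
have pos (f : Cn -> R) : {for z, continuous f} -> f z != 0 ->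
    exists2 s : R, 0 < s & forall y, norm1 (y - z) < s -> `|f z| / 2 <= `|f y|.
  move=> cf fz; have e0 : 0 < `|f z| / 2 by rewrite divr_gt0 ?normr_gt0.
  have [s s0 hs] := continuous_norm1 cf e0; exists s => // y /hs h.
  have := ler_normD (f z - f y) (f y); rewrite subrK distrC; lra.
have [rz|rz] := eqVneq (r0 z) 0; last first.
  have [s s0 hs] := pos _ (c0 z Uz) rz.
  exists s, (`|r0 z| / 2); split => //; first by rewrite divr_gt0 ?normr_gt0.
  by move=> y /hs h; apply: le_trans h _; rewrite lerDl grad2_ge0.
have bz : boundary G0 z := defining_boundary oG0 dG0 Uz rz.
have [a ha] : exists a, rpartial a r0 z != 0.
  apply: contrapT => hno; have [_ _ _ _ /(_ z bz)/negP] := dG0; apply.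
  have h a : rpartial a r0 z = 0.
    by apply/eqP/negPn/negP => h; apply: hno; exists a.
  by apply/eqP/rowP => k; rewrite !mxE !h mul0r.
have ca : {for z, continuous (rpartial a r0)} by have [] := d0 a z Uz.
have [s s0 hs] := pos _ ca ha.
exists s, ((`|rpartial a r0 z| / 2) ^+ 2); split => //.
  by rewrite exprn_gt0 // divr_gt0 ?normr_gt0.
move=> y /hs h; apply: (@le_trans _ _ (grad2 r0 y)); last by rewrite lerDr.
apply: (@le_trans _ _ (rpartial a r0 y ^+ 2)).
  by rewrite -(real_normK (num_real (rpartial a r0 y))) lerXn2r // nnegrE divr_ge0.
by rewrite /grad2 (bigD1 a) //= lerDl sumr_ge0 // => b _; exact: sqr_ge0.
Qed.

Lemma nondegenerate_on_thickening : exists2 M : R, 0 < M & forall l y, L l -> norm1 (y - l) < M^-1 ->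
  [/\ U y, forall a, `|rpartial a r0 y| <= M,
      forall a b, `|rpartial b (rpartial a r0) y| <= M
    & M^-1 <= `|r0 y| + grad2 r0 y].
Proof.
have [|M M0 h] := @compact_large _ _ L (fun M l => forall y, norm1 (y - l) < M^-1 ->
  [/\ U y, forall a, `|rpartial a r0 y| <= M,
      forall a b, `|rpartial b (rpartial a r0) y| <= M
    & M^-1 <= `|r0 y| + grad2 r0 y]) cL; last first.
  by exists M => // l y Ll; exact: h (lexx _) Ll y.
move=> l Ll; have Ul := LU Ll; have [[c0 d0] d20] := C2r0.
have [s1 s10 h1] := open_norm1 oU Ul.
have [s2 s20 h2] := continuous_bound (fun a => (d0 a l Ul).2).
have cab (ab : ('I_n * bool) * ('I_n * bool)) :
    {for l, continuous (rpartial ab.2 (rpartial ab.1 r0))}.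
  by have [_ /(_ ab.2 l Ul)[]] := d20 ab.1.
have [s3 s30 h3] := continuous_bound cab.
have [s4 [m [s40 m0 h4]]] := nondegenerate_near Ll.
set B2 := 1 + _ in h2; set B3 := 1 + _ in h3.
pose s := Num.min (Num.min s1 s2) (Num.min s3 s4).
have s0 : 0 < s by rewrite !lt_min s10 s20 s30.
have s20' : 0 < s / 2 by rewrite divr_gt0.
exists (Num.max (Num.max B2 B3) (Num.max m^-1 (s / 2)^-1)), (s / 2).
split => // M l'; rewrite !ge_max => /andP[/andP[M2 M3] /andP[Mm Ms]] l'l y yl'.
have yl : norm1 (y - l) < s.
  have := norm1_tri l' y l; have := invf_le s20' Ms; lra.
move: yl; rewrite !lt_min => /andP[/andP[/h1 Uy /h2 y2] /andP[/h3 y3 /h4 y4]].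
split => // [a|a b|].
- exact: le_trans (y2 a) M2.
- exact: le_trans (y3 (a, b)) M3.
- exact: le_trans (invf_le m0 Mm) y4.
Qed.

(** The bounds of [nondegenerate_on_thickening] survive a C^2-small perturbation of
[r0]: the squared gradient changes by at most [N e (2 M + 1)]. *)
Lemma uniform_control : exists e s B m : R, [/\ 0 < e, 0 < s, 0 < B, 0 < m &
  forall G r, close_to U L r0 e G r -> forall l y, L l -> norm1 (y - l) < s ->
  [/\ U y, forall a, `|rpartial a r y| <= B,
      forall a b, `|rpartial b (rpartial a r) y| <= B
    & m <= `|r y| + grad2 r y]].
Proof.
have [M M0 hM] := nondegenerate_on_thickening.
have iM : 0 < M^-1 by rewrite invr_gt0.
pose N : R := \sum_(a : 'I_n * bool) 1.
have N0 : 0 <= N by apply: sumr_ge0.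
have X0 : 0 < 1 + N * (2 * M + 1).
  by rewrite ltr_pwDl // mulr_ge0 // addr_ge0 // mulr_ge0 // ltW.
pose e := Num.min 1 (M^-1 / 2 / (1 + N * (2 * M + 1))).
have e0 : 0 < e by rewrite lt_min ltr01 !divr_gt0.
have e1 : e <= 1 by rewrite ge_min lexx.
have eX : e * (1 + N * (2 * M + 1)) <= M^-1 / 2.
  by rewrite -ler_pdivlMr // ge_min lexx orbT.
exists e, M^-1, (M + 1), (M^-1 / 2); split => //; [exact: addr_gt0 | exact: divr_gt0 |].
move=> G r cG l y Ll yl; have [Uy b1 b2 b3] := hM l y Ll yl.
have [c1 c2 c3] := close_to_sub C2r0 cG Uy.
have tri (p q : R) : `|p - q| < e -> `|q| <= M -> `|p| <= M + 1.
  by move=> pq qM; have := ler_normD (p - q) q; rewrite subrK; lra.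
split => // [a|a b|].
- exact: tri (c2 a) (b1 a).
- exact: tri (c3 a b) (b2 a b).
- have hr : `|r0 y| <= `|r y| + e.
    have := ler_normD (r0 y - r y) (r y); rewrite subrK distrC; lra.
  have hg : grad2 r0 y <= grad2 r y + e * (N * (2 * M + 1)).
    rewrite /N mulr_suml mulr_sumr -big_split /=; apply: ler_sum => a _.
    rewrite mul1r; move: (c2 a) (b1 a) (tri _ _ (c2 a) (b1 a)).
    move: (rpartial a r y) (rpartial a r0 y) => p q pq qM pM.
    rewrite -lerBlDl -[_ ^+ 2 - _]opprB subr_sqr -mulNr opprB.
    apply: (le_trans (ler_norm _)); rewrite normrM distrC.
    apply: ler_pM => //; first exact: ltW.
    by apply: (le_trans (ler_normD _ _)); lra.
  lra.
Qed.

(** Chains from [K] to the base point, from there to a deep point, and finally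
along the disc of [disc_estimate] if [w] itself is not deep. For deep [w] the
logarithm on the right-hand side is bounded, as [L] and [w] lie in a fixed ball. *)
Lemma kobayashi_upper_bound (K : set Cn) : compact K -> K `<=` G0 ->
  exists e C : R, [/\ 0 < e, 0 < C & forall G r, close_to U L r0 e G r ->
    forall z w, K z -> G w ->
      (kobayashi G z w <= (- (2^-1 * ln (eudist w (boundary G))) + C)%:E)%E].
Proof.
move=> cK KG; have [[_ _ [b Gb]] _] := bG0.
have [MK MK0 hK] := joined_compact n0 cL LU bG0 LG0 dG0 Gb cK KG.
have [e [s [B [m [e0 s0 B0 m0 hu]]]]] := uniform_control.
have s2 : 0 < s / 2 by rewrite divr_gt0.
have m2 : 0 < m / 2 by rewrite divr_gt0.
have [k [C1 [C2 [k0 C10 C20 hd]]]] := @disc_estimate R n _ _ _ s2 B0 m2.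
pose k' := Num.min k (m / 2); have k'0 : 0 < k' by rewrite lt_min k0.
have [M M0 hM] := joined_deep n0 cL LU bG0 LG0 dG0 Gb k'0 s2.
have [D D0 hD] := compact_norm1_bounded cL.
pose C := MK + M + `|2^-1 * ln C1 + 2^-1 * ln C2| + `|2^-1 * ln (2 * D)|.
exists (Num.min e (Num.min MK^-1 M^-1)), C; split.
- by rewrite !lt_min e0 !invr_gt0 MK0.
- by rewrite /C; have := normr_ge0 (2^-1 * ln C1 + 2^-1 * ln C2);
    have := normr_ge0 (2^-1 * ln (2 * D)); lra.
move=> G r cG z w Kz Gw.
have ce : close_to U L r0 e G r by apply: close_to_le cG; rewrite ge_min lexx.
have cK' : close_to U L r0 MK^-1 G r.
  by apply: close_to_le cG; rewrite !ge_min lexx orbT.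
have cM : close_to U L r0 M^-1 G r.
  by apply: close_to_le cG; rewrite !ge_min lexx !orbT.
have [bG LG dG _] := cG; have oG : open G by case: bG => -[].
have [q bq] := bounded_boundary_nonempty n0 bG.
have dist0 := eudist_gt0 n0 oG (ex_intro _ q bq) Gw.
have [_ jK] := hK G r z cK' Kz.
apply: kobayashi_joined.
(* [w] is deep if it is far from [L] or if [r w <= - k'] *)
have [deep|ndeep] := pselect (forall l, L l -> norm1 (w - l) < s / 2 -> r w <= - k').
  have [jM _] := hM G r w cM Gw deep.
  apply: joined_le (joined_trans jK jM).
  have wD : norm1 w < D by apply: (bounded_domain_norm1 D0 bG) Gw => x /LG /hD.
  have dD : eudist w (boundary G) <= 2 * D.
    apply: (le_trans (eudist_le w bq)); apply: (le_trans (enorm_le_norm1 _)).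
    apply: (le_trans (norm1D _ _)); rewrite norm1N.
    by have := hD q (LG q bq); lra.
  have hl : ln (eudist w (boundary G)) <= ln (2 * D).
    by rewrite ler_ln // posrE mulr_gt0.
  have h2 : 2^-1 * ln (eudist w (boundary G)) <= 2^-1 * ln (2 * D) by rewrite ler_pM2l.
  have := ler_norm (2^-1 * ln (2 * D)).
  by have := normr_ge0 (2^-1 * ln C1 + 2^-1 * ln C2); rewrite /C; lra.
have [l [Ll wl kw]] : exists l, [/\ L l, norm1 (w - l) < s / 2 & - k' < r w].
  apply: contrapT => hno; apply: ndeep => l Ll wl; rewrite leNgt; apply/negP => h.
  by apply: hno; exists l.
have ctl : controlled U r (s / 2) B w.
  move=> y yw; have yl : norm1 (y - l) < s by have := norm1_tri w y l; lra.
  by have [? ? ? _] := hu G r ce l y Ll yl.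
have wls : norm1 (w - l) < s by lra.
have [Uw _ _ hm] := hu G r ce l w Ll wls.
have rw0 : r w < 0 by apply/(defining_in dG Uw).
have kk : k' <= k by rewrite ge_min lexx.
have km : k' <= m / 2 by rewrite ge_min lexx orbT.
have hg : m / 2 <= grad2 r w by move: hm; rewrite ltr0_norm //; lra.
have kw' : - k < r w by lra.
have [c [Uc Gc rc jc dc]] := hd G U r w oG dG Gw ctl hg kw'.
have [jM _] : joined G M b c /\ joined G M c b.
  by apply: (hM G r) => // l' _ _; lra.
apply: joined_le (joined_trans (joined_trans jK jM) jc).
have eta0 : 0 < - r w by rewrite oppr_gt0.
have hl : ln (eudist w (boundary G)) <= ln C2 + ln (- r w).
  by rewrite -lnM ?posrE // ler_ln ?posrE // mulr_gt0.
rewrite ln_div ?posrE //.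
have h1 := ler_norm (2^-1 * ln C1 + 2^-1 * ln C2).
have h2 := normr_ge0 (2^-1 * ln (2 * D)).
have h3 : 2^-1 * ln (eudist w (boundary G)) <= 2^-1 * (ln C2 + ln (- r w)).
  by rewrite ler_pM2l.
by rewrite /C; lra.
Qed.

End Uniform.

Theorem proposition3p3 (R : realType) (n : nat) (n_gt0 : (0 < n)%N) :
  (forall (T : metricType R) (G : T -> set 'rV[R[i]]_n)
          (U : set 'rV[R[i]]_n) (r : T -> 'rV[R[i]]_n -> R)
          (K : set 'rV[R[i]]_n),
     compact [set: T] ->
     (forall t, bounded_domain (G t) /\ C2_boundary (G t)) ->
     domain U -> relcompact U [set: 'rV[R[i]]_n] ->
     relcompact (\bigcup_t boundary (G t)) U ->
     (forall t, defining_function (G t) U (r t)) ->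
     (forall e : R, 0 < e -> exists2 d : R, 0 < d &
        forall s t : T, mdist s t <= d ->
          (C2norm U (fun z => (r t z - r s z)%R) < e%:E)%E) ->
     compact K ->
     (forall t, K `<=` G t) ->
     exists2 C : R, 0 < C &
       forall t z w, K z -> G t w ->
         (kobayashi (G t) z w
            <= (- (2^-1 * ln (eudist w (boundary (G t)))) + C)%:E)%E)
  /\
  (forall (Gs : nat -> set 'rV[R[i]]_n) (G : set 'rV[R[i]]_n),
     (forall j, bounded_domain (Gs j) /\ C2_boundary (Gs j)) ->
     bounded_domain G -> C2_boundary G ->
     C2_converges Gs G ->
     forall K : set 'rV[R[i]]_n, compact K -> K `<=` G ->
       exists2 C1 : R, 0 < C1 &
         exists j1 : nat, forall j, (j1 <= j)%N ->
           forall z w, K z -> Gs j w ->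
             (kobayashi (Gs j) z w
                <= (- (2^-1 * ln (eudist w (boundary (Gs j)))) + C1)%:E)%E).
Proof.
split.
- move=> T G U r K cT hG [oU _ _] _ [cL LU] dG hr cK KG.
  have LG t : boundary (G t) `<=` closure (\bigcup_t boundary (G t)).
    by move=> z bz; apply: subset_closure; exists t.
  have /compact_near_coveringP cov := cT.
  have [] := cov R (pinfty_nbhs R) (fun C t => forall z w, K z -> G t w ->
    (kobayashi (G t) z w <= (- (2^-1 * ln (eudist w (boundary (G t)))) + C)%:E)%E) _.
    move=> t _.
    have [e [C [e0 C0 h]]] := kobayashi_upper_bound n_gt0 cL LU (hG t).1 (LG t) (dG t) cK (KG t).
    have [d d0 hd] := hr e e0.
    exists ([set s | mdist t s < d], [set M | C < M]).
      split; last by exists C; split => //; exact: num_real.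
      by rewrite /= -metricType_numDomainType.filter_from_mdist_nbhs; exists d.
    move=> [s M] [/= /ltW ts CM] z w Kz Gw.
    have cl : close_to U (closure (\bigcup_t boundary (G t))) (r t) e (G s) (r s).
      by split; [exact: (hG s).1 | exact: LG | exact: dG | exact: hd].
    apply: (le_trans (h _ _ cl z w Kz Gw)).
    by rewrite lee_fin lerD2l ltW.
  move=> M [_ hM]; exists (Num.max M 0 + 1).
    by rewrite ltr_pwDr // le_max lexx orbT.
  move=> t z w; apply: hM => //.
  by rewrite ltr_pwDr // le_max lexx.
- move=> Gs G hGs bG _ [U [j0 [oU _ [cL LU] [r [rs [dG dGs hc]]]]]] K cK KG.
  set L := closure _ in cL LU.
  have LG : boundary G `<=` L by move=> z bz; apply: subset_closure; left.
  have LGs j : (j0 <= j)%N -> boundary (Gs j) `<=` L.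
    by move=> jj z bz; apply: subset_closure; right; exists j.
  have [e [C [e0 C0 h]]] := kobayashi_upper_bound n_gt0 cL LU bG LG dG cK KG.
  exists C => //.
  have ne : nbhs (0%E : \bar R) [set x | (x < e%:E)%E].
    rewrite /nbhs /= /ereal_nbhs /=.
    by apply: filterS (lt_nbhsl e0) => x /=; rewrite lte_fin.
  have [j1 _ hj1] := hc _ ne.
  exists (maxn j0 j1) => j; rewrite geq_max => /andP[jj0 jj1] z w Kz Gw.
  apply: (h _ (rs j) _ z w Kz Gw); split.
  + exact: (hGs j).1.
  + exact: LGs.
  + exact: dGs.
  + exact: hj1.
Qed.
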